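(* Let $q$ be a fixed integer and let $H:\mathbb{R}^q\to\mathbb{R}$ be a finite concave $\mathcal{C}^3(\mathbb{R}^q)$ function of the form $H(z)=H_1(z_1)+\dots+H_q(z_q)$. Let $\beta>0$ be such that the Gibbs ensemble $P_{n,\beta}$ determined by $H$ has a unique equilibrium macrostate $z_\beta$. Suppose that $H$ and $\beta$ satisfy the Riemann-sum condition (RS) and the local contraction condition (LC) stated in the context. Then the mixing time of the Glauber dynamics for $P_{n,\beta}$ satisfies $$t_{\mathrm{mix}} = O(n\log n)\qquad (n\to\infty),$$ i.e. for every fixed $\epsilon\in(0,1)$ one has $t_{\mathrm{mix}}(\epsilon)=O(n\log n)$ as $n\to\infty$.
   Context: **Gibbs ensemble.** Let $\Lambda=\{e^1,\dots,e^q\}$ be the standard basis of $\mathbb{R}^q$. A configuration is $\omega=(\omega_1,\dots,\omega_n)\in\Lambda^n$. Its empirical (magnetization) vector is $L_n(\omega)=(L_{n,1}(\omega),\dots,L_{n,q}(\omega))$ with $L_{n,k}(\omega)=\frac1n\#\{i:\omega_i=e^k\}$. It takes values in the simplex $\mathcal{P}=\{\nu\in\mathbb{R}^q:\nu_k\ge 0,\ \sum_k\nu_k=1\}$. The Gibbs measure $P_{n,\beta}$ is the probability measure on $\Lambda^n$ with density proportional to $\exp\{-\beta nH(L_n(\omega))\}$ with respect to the product measure $P_n$ with identical marginals $\rho$, where $\rho$ is uniform on $\Lambda$. **Equilibrium macrostates.** $\mathcal{E}_\beta$ is the set of $\nu\in\mathcal{P}$ minimizing $R(\nu|\rho)+\beta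 H(\nu)$ over $\mathcal{P}$, where $R(\nu|\rho)=\sum_{k=1}^q\nu_k\log(\nu_k/\rho_k)$, $\rho_k=1/q$. The assumption is $\mathcal{E}_\beta=\{z_\beta\}$. **Glauber dynamics.** The Markov chain on $\Lambda^n$ which at each step selects a vertex $i\in\{1,\dots,n\}$ uniformly at random and, if the current configuration is $\sigma$, replaces the spin at $i$ by $e^k$ with probability $$P(\sigma\to\sigma_{i,e^k})=\frac{\exp\{-\beta nH(L_n(\sigma_{i,e^k}))\}}{\sum_{\ell=1}^q\exp\{-\beta nH(L_n(\sigma_{i,e^\ell}))\}},$$ where $\sigma_{i,e^k}$ agrees with $\sigma$ off $i$ and has spin $e^k$ at $i$. Its stationary distribution is $P_{n,\beta}$. With $P^t(x,\cdot)$ the $t$-step transition probabilities, $d(t)=\max_{x\in\Lambda^n}\|P^t(x,\cdot)-P_{n,\beta}\|_{TV}$ and $t_{\mathrm{mix}}(\epsilon)=\min\{t:d(t)\le\epsilon\}$, where $\|\cdot\|_{TV}$ is total variation distance. **The map $g^{H,\beta}$.** For $z\in\mathbb{R}^q$ and $\ell=1,\dots,q$, $$g^{H,\beta}_\ell(z)=\frac{\exp(-\beta\,\partial_\ell H(z))}{\sum_{k=1}^q\exp(-\beta\,\partial_kH(z))},\qquad g^{H,\beta}=(g_1^{H,\beta},\dots,g_q^{H,\beta}).$$ **Aggregate $g$-variation.** For $x,z\in\mathcal{P}$ and a continuous path $\rho$ in $\mathcal{P}$ from $x$ to $z$ that is monotone in each coordinate, $D^g_\rho(x,z)=\sum_{k=1}^q\int_\rho|\langle\nabla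 g_k^{H,\beta}(y),dy\rangle|$ (the sum over $k$ of the total variations of $g_k^{H,\beta}$ along $\rho$). Put $d_g(x,z)=\inf_\rho D^g_\rho(x,z)$, the infimum being over all continuous coordinatewise-monotone paths in $\mathcal{P}$ connecting $x$ and $z$. **Uniform condition (U), fixing $\delta$.** There exists $\delta\in(0,1)$ such that $d_g(z,z_\beta)/\|z-z_\beta\|_1\le 1-\delta$ for all $z\in\mathcal{P}$, $z\ne z_\beta$. **Neo-geodesic family $\mathbf{NG}_\delta$.** With (U) satisfied with constant $\delta$, a neo-geodesic family $\mathbf{NG}_\delta$ is a family of smooth curves in $\mathcal{P}$, monotone in each coordinate, such that for each $z\neq z_\beta$ in $\mathcal{P}$ there is exactly one curve $\rho_z$ in the family connecting $z_\beta$ to $z$, and $D^g_{\rho_z}(z,z_\beta)/\|z-z_\beta\|_1\le 1-\delta/2$. **Condition (RS)** (which presupposes (U), with the same $\delta$). For all sufficiently small $\varepsilon>0$ there exists a neo-geodesic family $\mathbf{NG}_\delta$ such that for each $z\in\mathcal{P}$ with $\|z-z_\beta\|_1\ge\varepsilon$, the curve $\rho_z$ of the family connecting $z_\beta$ to $z$ satisfies $$\frac{\sum_{k=1}^q\sum_{i=1}^m|\langle z_i-z_{i-1},\nabla g_k^{H,\beta}(z_{i-1})\rangle|}{\|z-z_\beta\|_1}\le 1-\delta/3$$ for a sequence of points $z_0=z_\beta,z_1,\dots,z_m=z$ interpolating $\rho_z$ (successive points on the curve) with $\varepsilon\le\|z_i-z_{i-1}\|_1<2\varepsilon$ for $i=1,\dots,m$.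 **Condition (LC).** $$\limsup_{z\to z_\beta}\frac{\|g^{H,\beta}(z)-g^{H,\beta}(z_\beta)\|_1}{\|z-z_\beta\|_1}<1\qquad(z\in\mathcal{P}).$$ *)

(* Defs.v *)
From HB Require Import structures.
From mathcomp Require Import all_boot all_order all_algebra.
From mathcomp Require Import all_classical all_reals all_analysis.
Set Implicit Arguments.
Unset Strict Implicit.
Unset Printing Implicit Defensive.
Import Order.TTheory GRing.Theory Num.Theory.
Import numFieldNormedType.Exports.
Local Open Scope classical_set_scope.
Local Open Scope ring_scope.

(* The topology of 'rV[R]_q is that of the library's sup norm; the l^1 norm of
   the quantitative conditions is therefore written explicitly. *)
Definition norm1 (R : realType) (q : nat) (v : 'rV[R]_q) : R :=
  \sum_(k < q) `|v 0 k|.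

Definition simplex (R : realType) (q : nat) : set 'rV[R]_q :=
  [set nu | (forall k, 0 <= nu 0 k) /\ \sum_(k < q) nu 0 k = 1].

Definition dot (R : realType) (q : nat) (u v : 'rV[R]_q) : R :=
  \sum_(k < q) u 0 k * v 0 k.

Definition partial (R : realType) (q : nat) (k : 'I_q) (f : 'rV[R]_q -> R)
  (z : 'rV[R]_q) : R := 'D_(delta_mx 0 k) f z.

Definition grad (R : realType) (q : nat) (f : 'rV[R]_q -> R) (z : 'rV[R]_q) :
  'rV[R]_q := \row_(k < q) partial k f z.

(* f is of class C^m: all partial derivatives of order <= m exist and are
   continuous. *)
Fixpoint class_C (R : realType) (q m : nat) (f : 'rV[R]_q -> R) : Prop :=
  continuous f /\
  match m with
  | 0%N => True
  | m'.+1 => forall k : 'I_q,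
      (forall z, derivable f z (delta_mx 0 k)) /\ class_C m' (partial k f)
  end.

Definition concave (R : realType) (q : nat) (H : 'rV[R]_q -> R) : Prop :=
  convex_function (E := 'rV[R]_q) [set: 'rV[R]_q] (fun z => - H z).

Definition separable (R : realType) (q : nat) (H : 'rV[R]_q -> R) : Prop :=
  exists h : 'I_q -> R -> R, forall z, H z = \sum_(k < q) h k (z 0 k).

(* A configuration is encoded by the indices of its spins: w i = k stands for
   omega_i = e^k. *)
Notation config q n := {ffun 'I_n -> 'I_q}.

Section Gibbs.
Context (R : realType) (q : nat).
Implicit Types (H : 'rV[R]_q -> R) (beta : R) (n : nat).

Definition uniform_spin : 'rV[R]_q := const_mx q%:R^-1.

Definition magnetization n (w : config q n) : 'rV[R]_q :=
  \row_(k < q) (#|[pred i | w i == k]|%:R / n%:R).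

Definition prior n (w : config q n) : R := \prod_(i < n) uniform_spin 0 (w i).

Definition boltzmann H beta n (w : config q n) : R :=
  expR (- (beta * n%:R * H (magnetization w))).

Definition gibbs H beta n (w : config q n) : R :=
  boltzmann H beta w * prior w /
  \sum_(w' : config q n) boltzmann H beta w' * prior w'.

(* Since ln 0 = 0 in the library, a vanishing coordinate contributes 0. *)
Definition relative_entropy (nu rho : 'rV[R]_q) : R :=
  \sum_(k < q) nu 0 k * ln (nu 0 k / rho 0 k).

Definition free_energy H beta (nu : 'rV[R]_q) : R :=
  relative_entropy nu uniform_spin + beta * H nu.

Definition equilibrium_macrostates H beta : set 'rV[R]_q :=
  [set nu | simplex nu /\
    forall mu, simplex mu -> free_energy H beta nu <= free_energy H beta mu].

End Gibbs.

Section Glauber.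
Context (R : realType) (q : nat).
Variables (H : 'rV[R]_q -> R) (beta : R) (n : nat).
Implicit Types s t : config q n.

Definition set_spin s (i : 'I_n) (k : 'I_q) : config q n :=
  [ffun j => if j == i then k else s j].

Definition update_prob s (i : 'I_n) (k : 'I_q) : R :=
  boltzmann H beta (set_spin s i k) /
  \sum_(l < q) boltzmann H beta (set_spin s i l).

Definition glauber s t : R :=
  \sum_(i < n) n%:R^-1 *
    \sum_(k < q) update_prob s i k * (t == set_spin s i k)%:R.

Fixpoint glauber_iter (m : nat) s t : R :=
  match m with
  | 0%N => (s == t)%:R
  | m'.+1 => \sum_(u : config q n) glauber s u * glauber_iter m' u t
  end.

Definition tv_distance (T : finType) (mu nu : T -> R) : R :=
  \big[Num.max/0]_(A : {set T}) `|\sum_(x in A) mu x - \sum_(x in A) nu x|.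

Definition mixing_distance (m : nat) : R :=
  \big[Num.max/0]_(s : config q n)
    tv_distance (glauber_iter m s) (@gibbs R q H beta n).

(* The least m with d(m) <= eps, read as +oo if there is no such m. *)
Definition t_mix (eps : R) : \bar R :=
  ereal_inf [set (m%:R)%:E | m in [set m : nat | mixing_distance m <= eps]].

End Glauber.

Section Conditions.
Context (R : realType) (q : nat).
Variables (H : 'rV[R]_q -> R) (beta : R).
Implicit Types (x z : 'rV[R]_q) (rho : R -> 'rV[R]_q) (delta eps : R).

Definition g_coord (l : 'I_q) z : R :=
  expR (- (beta * partial l H z)) /
  \sum_(k < q) expR (- (beta * partial k H z)).

Definition g_map z : 'rV[R]_q := \row_(l < q) g_coord l z.

(* Curves are parametrized by [0, 1]; values outside [0, 1] are irrelevant. *)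
Definition monotone_path rho x z : Prop :=
  [/\ {within `[0, 1], continuous rho},
      rho 0 = x, rho 1 = z,
      forall t, t \in `[0, 1] -> simplex (rho t) &
      forall k : 'I_q,
        {in `[0, 1] &, {homo (fun t => rho t 0 k) : s t / s <= t}} \/
        {in `[0, 1] &, {homo (fun t => rho t 0 k) : s t /~ s <= t}}].

(* Infinitely differentiable on [0, 1] in the sense of being the restriction of
   an infinitely differentiable map defined on the whole line. *)
Definition smooth_path rho : Prop :=
  exists2 r : R -> 'rV[R]_q, (forall t, t \in `[0, 1] -> r t = rho t) &
    forall (m : nat) (t : R), derivable (derive1n m r) t 1.

(* The integral of |<grad g_k(y), dy>| along a continuous monotone path is the
   total variation of g_k along the path. *)
Definition g_variation rho : \bar R :=
  (\sum_(k < q) total_variation 0 1 (fun t => g_coord k (rho t)))%E.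

Definition d_g x z : \bar R :=
  ereal_inf [set g_variation rho | rho in [set rho | monotone_path rho x z]].

Variable zb : 'rV[R]_q.

Definition uniform_condition delta : Prop :=
  0 < delta < 1 /\
  forall z, simplex z -> z != zb ->
    (d_g z zb * ((norm1 (z - zb))^-1)%:E <= (1 - delta)%:E)%E.

(* The family is indexed by the endpoints z != zb of its curves, which encodes
   that it has exactly one curve from zb to each z. *)
Definition neo_geodesic delta (NG : 'rV[R]_q -> R -> 'rV[R]_q) : Prop :=
  forall z, simplex z -> z != zb ->
    [/\ monotone_path (NG z) zb z, smooth_path (NG z) &
        (g_variation (NG z) * ((norm1 (z - zb))^-1)%:E
           <= (1 - delta / 2)%:E)%E].

(* The interpolating points are z_i = rho (s i), for 0 <= i <= m. *)
Definition riemann_sum_bound delta eps rho z : Prop :=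
  exists (m : nat) (s : nat -> R),
    [/\ s 0%N = 0, s m = 1,
        forall i, (i < m)%N -> s i < s i.+1,
        forall i, (i < m)%N ->
          eps <= norm1 (rho (s i.+1) - rho (s i)) < 2 * eps &
        (\sum_(k < q) \sum_(i < m)
           `|dot (rho (s i.+1) - rho (s i)) (grad (g_coord k) (rho (s i)))|)
          / norm1 (z - zb) <= 1 - delta / 3].

Definition riemann_sum_condition : Prop :=
  exists delta, uniform_condition delta /\
    \forall eps \near 0^'+, exists2 NG, neo_geodesic delta NG &
      forall z, simplex z -> eps <= norm1 (z - zb) ->
        riemann_sum_bound delta eps (NG z) z.

Definition local_contraction : Prop :=
  (limf_esup (fun z => (norm1 (g_map z - g_map zb) / norm1 (z - zb))%:E)
     (within (@simplex R q) zb^') < 1)%E.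

End Conditions.

(* Main.v *)
Require Import Defs.
From mathcomp Require Import all_boot all_order all_algebra.
From mathcomp Require Import all_classical all_reals all_analysis.
From mathcomp Require Import ring lra.
Set Implicit Arguments.
Unset Strict Implicit.
Unset Printing Implicit Defensive.
Import Order.TTheory GRing.Theory Num.Theory.
Import numFieldNormedType.Exports.
Local Open Scope classical_set_scope.
Local Open Scope ring_scope.

(* Coupling in the Wasserstein distance, in dual form, of two copies sigma and
   tau of the chain, with tau stationary.

   The variation of g along a path from z to z_beta dominates
   |g(z) - g(z_beta)|_1, so (U) makes g contract towards z_beta by the factor
   1 - delta.  The point z_beta is interior, hence the derivative of g at z_beta
   contracts all tangent vectors, and g contracts pairs of points near z_beta.
   If y is much closer to z_beta than x is, then g contracts (x, y) too.  The
   spin update probabilities are finite difference versions of g, at distance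
   O(1/n) from it, uniformly, and strictly close to its linearization at z_beta.
   So, as soon as the magnetization of tau is close to z_beta, the update
   distributions at a site for sigma and tau are at total variation distance at
   most (1 - delta/2) d(sigma, tau) / n, with d the Hamming distance, and one
   step of the dynamics contracts d by the factor 1 - delta/(2n).

   Taking tau stationary, the steps at which its magnetization is far from z_beta
   contribute an exponentially small error: concavity of H gives the partition
   function the exact lower bound exp(-n F(z_beta)), F being the free energy, and
   a configuration of magnetization L has Gibbs weight at most
   prod_i L_(sigma_i) exp(-n (F(L) - F(z_beta))). *)

(** * Contraction of the Glauber operator *)

(* Truncating [v] at height [a] above its minimum replaces an optimal coupling
   of [p] and [p']. *)
Lemma dual_coupling_bound (R : realType) (q : nat) (p p' u v : 'I_q -> R) (M a : R) :
  0 <= a -> (forall k, 0 <= p k) -> (forall k, 0 <= p' k) ->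
  \sum_k p k = 1 -> \sum_k p' k = 1 ->
  (forall k, u k - v k <= M) -> (forall k l, u k - v l <= M + a) ->
  \sum_k p k * u k - \sum_k p' k * v k
    <= M + 2^-1 * (\sum_k `|p k - p' k|) * a.
Proof.
move=> a0 p0 p'0 p1 p'1 uv uva.
case: q p p' u v p0 p'0 p1 p'1 uv uva => [|q] p p' u v p0 p'0 p1 p'1 uv uva.
  by move: p1; rewrite big_ord0 => /eqP; rewrite eq_sym oner_eq0.
have [l0 l0P] : exists l0, forall l, v l0 <= v l.
  by case: (@Order.TotalTheory.arg_minP _ R _ ord0 predT v isT) => i _ h; exists i => l; exact: h.
(* [w] lies below [v], ranges over an interval of length [a], and still satisfies [u k <= w k + M]:
   where it is truncated, the bound on [u k - v l0] applies. *)
pose w k := Num.min (v k) (v l0 + a).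
have wv k : w k <= v k by rewrite /w ge_min lexx.
have uw k : u k <= w k + M.
  rewrite /w; have := uv k; have := uva k l0.
  by case: (leP (v k)) => ? ? ?; lra.
have wmid k : `|w k - v l0 - a / 2| <= a / 2.
  rewrite ler_norml /w; have := l0P k.
  by case: (leP (v k)) => ? ?; apply/andP; split; lra.
have -> : M + 2^-1 * (\sum_k `|p k - p' k|) * a =
  \sum_k (p k * M) + \sum_k (`|p k - p' k| * (a / 2)).
  by rewrite -!mulr_suml p1; ring.
(* Since [p] and [p'] have equal mass, [w] may be centred at the midpoint of its range; its radius
   [a / 2] yields the factor 1/2. *)
have h : \sum_k (p k - p' k) * w k <= \sum_k (`|p k - p' k| * (a / 2)).
  have -> : \sum_k (p k - p' k) * w k =
    \sum_k (p k - p' k) * (w k - v l0 - a / 2) + \sum_k (p k - p' k) * (v l0 + a / 2).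
    by rewrite -big_split /=; apply: eq_bigr => k _; ring.
  rewrite -[X in _ + X]mulr_suml sumrB p1 p'1 subrr mul0r addr0.
  apply: ler_sum => k _; apply: (le_trans (ler_norm _)).
  by rewrite normrM ler_wpM2l.
have h1 : \sum_k p k * u k <= \sum_k p k * (w k + M).
  by apply: ler_sum => k _; rewrite ler_wpM2l.
have h2 : \sum_k p' k * w k <= \sum_k p' k * v k.
  by apply: ler_sum => k _; rewrite ler_wpM2l.
have h3 : \sum_k p k * (w k + M) = \sum_k p k * w k + \sum_k p k * M.
  by rewrite -big_split /=; apply: eq_bigr => k _; ring.
have h4 : \sum_k (p k - p' k) * w k = \sum_k p k * w k - \sum_k p' k * w k.
  by rewrite -sumrB; apply: eq_bigr => k _; ring.
lra.
Qed.

(** * Hamming distance between configurations *)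

Definition hamming (R : realType) (q n : nat) (s t : config q n) : R :=
  \sum_(i < n) (s i != t i)%:R.

Lemma hamming_ge0 (R : realType) (q n : nat) (s t : config q n) : 0 <= hamming R s t.
Proof. by apply: sumr_ge0 => i _; rewrite ler0n. Qed.

Lemma hamming_le (R : realType) (q n : nat) (s t : config q n) : hamming R s t <= n%:R.
Proof.
rewrite -[leRHS]mul1r mulr_natr -[X in 1 *+ X]card_ord -sumr_const.
by apply: ler_sum => i _; case: (_ != _).
Qed.

Lemma hamming_ge1 (R : realType) (q n : nat) (s t : config q n) :
  s != t -> 1 <= hamming R s t.
Proof.
move=> st; have [i sti] : exists i, s i != t i.
  apply/existsP; apply: contraNT st; rewrite negb_exists => /forallP h.
  by apply/eqP/ffunP => i; have := h i; rewrite negbK => /eqP.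
rewrite /hamming (bigD1 i) //= sti lerDl.
by apply: sumr_ge0 => j _; rewrite ler0n.
Qed.

Lemma hamming_set_spin (R : realType) (q n : nat) (s t : config q n) i k l :
  hamming R (set_spin s i k) (set_spin t i l) =
  hamming R s t - (s i != t i)%:R + (k != l)%:R.
Proof.
rewrite /hamming (bigD1 i) //= [in RHS](bigD1 i) //= !ffunE eqxx.
rewrite [X in _ + X](_ : _ = \sum_(i0 < n | i0 != i) (s i0 != t i0)%:R); first by ring.
by apply: eq_bigr => j /negPf ji; rewrite !ffunE ji.
Qed.

Section GlauberOperator.
Context (R : realType) (q : nat) (H : 'rV[R]_q -> R) (beta : R) (n : nat).
Implicit Types (s t : config q n) (f : config q n -> R).

Local Notation p := (update_prob H beta).
Local Notation P := (@glauber R q H beta n).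
Local Notation pi := (@gibbs R q H beta n).
Local Notation w := (@boltzmann R q H beta n).

Lemma boltzmann_gt0 s : 0 < w s. Proof. exact: expR_gt0. Qed.

Lemma update_prob_ge0 s i k : 0 <= p s i k.
Proof. by rewrite divr_ge0 ?sumr_ge0// => *; apply/ltW/boltzmann_gt0. Qed.

Lemma boltzmann_sum_gt0 s i : 0 < \sum_(l < q) w (set_spin s i l).
Proof.
rewrite (bigD1 (s i)) //= ltr_wpDr ?boltzmann_gt0 ?sumr_ge0// => *.
exact/ltW/boltzmann_gt0.
Qed.

Lemma sum_update_prob s i : \sum_k p s i k = 1.
Proof. by rewrite -mulr_suml divff// gt_eqF// boltzmann_sum_gt0. Qed.

Lemma half_update_prob_dist_le1 s t i : 2^-1 * (\sum_k `|p s i k - p t i k|) <= 1.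
Proof.
have : \sum_k `|p s i k - p t i k| <= \sum_k (p s i k + p t i k).
  apply: ler_sum => k _; apply: (le_trans (ler_normB _ _)).
  by rewrite !ger0_norm ?update_prob_ge0.
by rewrite big_split /= !sum_update_prob; lra.
Qed.

Lemma glauber_applyE f s :
  \sum_t P s t * f t =
  \sum_(i < n) n%:R^-1 * \sum_(k < q) p s i k * f (set_spin s i k).
Proof.
under eq_bigr do rewrite /glauber mulr_suml.
rewrite exchange_big /=; apply: eq_bigr => i _.
under eq_bigr do rewrite -mulrA mulr_suml.
rewrite -mulr_sumr exchange_big /=; congr (_ * _); apply: eq_bigr => k _.
rewrite (bigD1 (set_spin s i k)) //= eqxx mulr1 big1 ?addr0// => t /negPf ->.
by rewrite mulr0 mul0r.
Qed.

Lemma glauber_iter_applyS f m s :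
  \sum_t glauber_iter H beta m.+1 s t * f t =
  \sum_u P s u * \sum_t glauber_iter H beta m u t * f t.
Proof.
under eq_bigr do rewrite /= mulr_suml.
rewrite exchange_big /=; apply: eq_bigr => u _.
by rewrite mulr_sumr; apply: eq_bigr => t _; rewrite mulrA.
Qed.

Lemma glauber_iter_apply0 f s : \sum_t glauber_iter H beta 0 s t * f t = f s.
Proof.
rewrite (bigD1 s) //= eqxx mul1r big1 ?addr0// => t.
by rewrite eq_sym => /negPf ->; rewrite mul0r.
Qed.

(* Expected number of visits to [bad] during the first [m] steps. *)
Fixpoint bad_time (bad : pred (config q n)) (m : nat) t : R :=
  if m is m'.+1 then (bad t)%:R + \sum_u P t u * bad_time bad m' u else 0.

(** Induction on [m]: both copies update the same site, and the update laws are compared through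
    [dual_coupling_bound]. When [t] is bad, their total variation distance is bounded by 1, and this
    loss is charged to [bad_time]. *)
Lemma glauber_iter_contraction (bad : pred (config q n)) (a : R) f m s t :
  (0 < n)%N -> 0 <= a <= 1 ->
  (forall s t i, ~~ bad t ->
     2^-1 * (\sum_k `|p s i k - p t i k|) <= (1 - a) * (hamming R s t / n%:R)) ->
  (forall s t, f s - f t <= hamming R s t) ->
  \sum_u glauber_iter H beta m s u * f u - \sum_u glauber_iter H beta m t u * f u
    <= (1 - a / n%:R) ^+ m * hamming R s t + bad_time bad m t.
Proof.
move=> n0 /andP[a0 a1] contr flip.
have nn0 : 0 < n%:R :> R by rewrite ltr0n.
have n1 : 1 <= n%:R :> R by rewrite ler1n.
have an1 : a / n%:R <= 1 by rewrite ler_pdivrMr// mul1r (le_trans a1).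
have an0 : 0 <= a / n%:R by rewrite divr_ge0// ltW.
elim: m s t => [|m IH] s t.
  by rewrite !glauber_iter_apply0 expr0 mul1r addr0.
rewrite !glauber_iter_applyS.
set F := fun u => \sum_t0 glauber_iter H beta m u t0 * f t0.
set b := (1 - a / n%:R) ^+ m.
have b0 : 0 <= b by apply: exprn_ge0; lra.
have b1 : b <= 1 by apply: exprn_ile1; lra.
(* Attaching the accumulated error to the second copy makes the induction hypothesis a pure
   Lipschitz bound on [F s - G t]. *)
pose G u := F u + bad_time bad m u.
suff : \sum_u P s u * F u - \sum_u P t u * G u <=
    (1 - a / n%:R) ^+ m.+1 * hamming R s t + (bad t)%:R.
  rewrite /=; have -> : \sum_u P t u * G u =
    \sum_u P t u * F u + \sum_u P t u * bad_time bad m u.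
    by rewrite -big_split /=; apply: eq_bigr => u _; rewrite mulrDr.
  by lra.
rewrite !glauber_applyE -sumrB.
have step i : n%:R^-1 * (\sum_(k < q) p s i k * F (set_spin s i k))
   - n%:R^-1 * (\sum_(k < q) p t i k * G (set_spin t i k)) <=
   n%:R^-1 * (b * (hamming R s t - (s i != t i)%:R) +
     2^-1 * (\sum_k `|p s i k - p t i k|) * b).
  rewrite -mulrBr; apply: ler_wpM2l; first by rewrite invr_ge0 ltW.
  (* After the update the distance splits into the disagreements off [i] and the new one at [i];
     they give the [M] and the [a] of [dual_coupling_bound]. *)
  have FG k l : F (set_spin s i k) - G (set_spin t i l) <=
      b * (hamming R s t - (s i != t i)%:R) + b * (k != l)%:R.
    have := IH (set_spin s i k) (set_spin t i l).
    by rewrite -/(F (set_spin s i k)) -/(F (set_spin t i l)) -/b hamming_set_spin mulrDr /G; lra.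
  apply: (@dual_coupling_bound _ _ (p s i) (p t i) (fun k => F (set_spin s i k))
    (fun k => G (set_spin t i k))) => //; try exact: update_prob_ge0;
    try exact: sum_update_prob.
  - by move=> k; have := FG k k; rewrite eqxx mulr0 addr0.
  - move=> k l; have := FG k l; case: (k != l) => /=; rewrite ?mulr1 ?mulr0; lra.
apply: (le_trans (ler_sum _ (fun i _ => step i))).
have bound i : n%:R^-1 * (b * (hamming R s t - (s i != t i)%:R) +
     2^-1 * (\sum_k `|p s i k - p t i k|) * b) <=
   n%:R^-1 * (b * (hamming R s t - (s i != t i)%:R) +
     ((1 - a) * (hamming R s t / n%:R) + (bad t)%:R) * b).
  apply: ler_wpM2l; first by rewrite invr_ge0 ltW.
  rewrite lerD2l; apply: ler_wpM2r => //.
  have d0 : 0 <= (1 - a) * (hamming R s t / n%:R).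
    by rewrite mulr_ge0 ?divr_ge0 ?hamming_ge0 ?subr_ge0// ltW.
  have [bt|bt] := boolP (bad t); last by rewrite addr0; exact: contr.
  by have := half_update_prob_dist_le1 s t i; rewrite mulr1n; lra.
apply: (le_trans (ler_sum _ (fun i _ => bound i))).
have sum_const (c : R) : \sum_(i < n) c = n%:R * c.
  by rewrite sumr_const card_ord mulr_natl.
rewrite -mulr_sumr big_split /= -mulr_sumr sumrB -[X in _ - X]/(hamming R s t).
rewrite !sum_const exprS -/b.
set h := hamming R s t.
(* On average over [i], forgetting the old spin removes [h / n] and the new spin puts back at most
   [(1 - a) * h / n], up to the bad term. *)
rewrite [leLHS](_ : _ = b * ((1 - a / n%:R) * h + (bad t)%:R)); last first.
  by field; rewrite gt_eqF.
rewrite mulrDr mulrA [b * (1 - _)]mulrC lerD2l; apply: ler_piMl => //.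
Qed.

(** * Stationarity of the Gibbs measure and the resulting mixing bound *)

Lemma set_spin_id s i : set_spin s i (s i) = s.
Proof. by apply/ffunP => j; rewrite ffunE; case: eqP => // ->. Qed.

Lemma set_spin_set s i k l : set_spin (set_spin s i k) i l = set_spin s i l.
Proof. by apply/ffunP => j; rewrite !ffunE; case: eqP. Qed.

Lemma set_spin_at s i k : set_spin s i k i = k.
Proof. by rewrite ffunE eqxx. Qed.

Lemma prior_const s : prior R s = q%:R^-1 ^+ n.
Proof.
rewrite /prior (eq_bigr (fun=> q%:R^-1)); last by move=> i _; rewrite mxE.
by rewrite prodr_const card_ord.
Qed.

Lemma gibbsE s : pi s = prior R s / (\sum_t w t * prior R t) * w s.
Proof. by rewrite /gibbs; ring. Qed.

(** Detailed balance for the update at [i]: the normalizing sum depends only on the spins off [i],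
    so the weight [w s * p s i k] is symmetric in the old and the new configuration. *)
Lemma boltzmann_update_stationary f i :
  \sum_s w s * (\sum_(k < q) p s i k * f (set_spin s i k)) = \sum_s w s * f s.
Proof.
(* Summing over all [t] that agree with [s] off [i], instead of over the new spin, makes the roles
   of [s] and [t] symmetric. *)
have E s : \sum_(k < q) p s i k * f (set_spin s i k) =
   \sum_(t : config q n) (t == set_spin s i (t i))%:R *
     (w t / (\sum_(l < q) w (set_spin s i l)) * f t).
  rewrite [RHS](partition_big (fun t : config q n => t i) predT) //=; apply: eq_bigr => k _.
  rewrite (bigD1 (set_spin s i k)) ?set_spin_at//= eqxx mul1r [X in _ + X]big1 ?addr0 //.
  by move=> t /andP[/eqP -> /negPf ->]; rewrite mul0r.
under eq_bigr do rewrite E mulr_sumr.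
rewrite exchange_big /=; apply: eq_bigr => t _.
rewrite [LHS](_ : _ = \sum_(s : config q n)
    w t * f t * (p t i (s i) * (s == set_spin t i (s i))%:R)).
  rewrite -mulr_sumr (partition_big (fun s : config q n => s i) predT) //=.
  rewrite (eq_bigr (p t i)) ?sum_update_prob ?mulr1// => k _.
  rewrite (bigD1 (set_spin t i k)) ?set_spin_at//= eqxx mulr1 big1 ?addr0//.
  by move=> s /andP[/eqP -> /negPf ->]; rewrite mulr0.
apply: eq_bigr => s _.
have -> : (t == set_spin s i (t i)) = (s == set_spin t i (s i)).
  by apply/eqP/eqP => ->; rewrite set_spin_set set_spin_id.
have [st|_] := eqVneq s (set_spin t i (s i)); last by rewrite !mul0r !mulr0.
have -> : \sum_(l < q) w (set_spin s i l) = \sum_(l < q) w (set_spin t i l).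
  by apply: eq_bigr => l _; rewrite st set_spin_set.
by rewrite /update_prob -st mul1r mulr1; ring.
Qed.

Lemma gibbs_stationary f : (0 < n)%N -> \sum_s pi s * (\sum_t P s t * f t) = \sum_s pi s * f s.
Proof.
move=> n0.
under eq_bigr do rewrite gibbsE prior_const glauber_applyE -mulrA mulr_sumr.
under [RHS]eq_bigr do rewrite gibbsE prior_const -mulrA.
rewrite -!mulr_sumr; congr (_ * _).
rewrite exchange_big /=.
under eq_bigr => i _ do under eq_bigr do rewrite mulrCA.
under eq_bigr => i _ do rewrite -mulr_sumr boltzmann_update_stationary.
rewrite sumr_const card_ord -[LHS]mulr_natl mulrA divff ?mul1r//.
by rewrite pnatr_eq0 -lt0n.
Qed.

Lemma gibbs_ge0 s : 0 <= pi s.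
Proof.
by rewrite divr_ge0 ?sumr_ge0// => *;
  rewrite prior_const mulr_ge0 ?exprn_ge0 ?invr_ge0// ltW// boltzmann_gt0.
Qed.

Lemma sum_gibbs : (0 < q)%N -> \sum_s pi s = 1.
Proof.
move=> q0; rewrite -mulr_suml divff// gt_eqF//.
rewrite (bigD1 [ffun=> Ordinal q0]) //= ltr_wpDr//.
  by apply: sumr_ge0 => s _;
    rewrite prior_const mulr_ge0 ?exprn_ge0 ?invr_ge0// ltW// boltzmann_gt0.
by rewrite prior_const mulr_gt0 ?boltzmann_gt0// exprn_gt0// invr_gt0 ltr0n.
Qed.

Lemma gibbs_iter_stationary f m : (0 < n)%N ->
  \sum_s pi s * (\sum_t glauber_iter H beta m s t * f t) = \sum_s pi s * f s.
Proof.
move=> n0; elim: m => [|m IH].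
  by apply: eq_bigr => s _; rewrite glauber_iter_apply0.
under eq_bigr do rewrite glauber_iter_applyS.
by rewrite (gibbs_stationary (fun u => \sum_t glauber_iter H beta m u t * f t)).
Qed.

(** A stationary chain is bad with the same probability at each of the [m] steps. *)
Lemma gibbs_bad_time bad m : (0 < n)%N ->
  \sum_s pi s * bad_time bad m s = m%:R * \sum_(s | bad s) pi s.
Proof.
move=> n0; elim: m => [|m IH] /=.
  by rewrite mul0r big1// => s _; rewrite mulr0.
under eq_bigr do rewrite mulrDr.
rewrite big_split /= gibbs_stationary// IH -[in RHS]natr1 mulrDl mul1r addrC; congr (_ + _).
by rewrite [RHS]big_mkcond; apply: eq_bigr => s _; case: (bad s); rewrite ?mulr1 ?mulr0.
Qed.

(** The second copy starts from [pi] and stays stationary, so averaging [glauber_iter_contraction]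
    over [t] compares the chain from [s] with [pi]. Indicators of events are 1-Lipschitz for the
    Hamming distance, whose maximum is at most [n]. *)
Lemma mixing_distance_le (bad : pred (config q n)) (a : R) m :
  (0 < q)%N -> (0 < n)%N -> 0 <= a <= 1 ->
  (forall s t i, ~~ bad t ->
     2^-1 * (\sum_k `|p s i k - p t i k|) <= (1 - a) * (hamming R s t / n%:R)) ->
  mixing_distance H beta n m <=
    (1 - a / n%:R) ^+ m * n%:R + m%:R * \sum_(s | bad s) pi s.
Proof.
move=> q0 n0 a01 contr.
have key f s : (forall s t, f s - f t <= hamming R s t) ->
    \sum_t glauber_iter H beta m s t * f t - \sum_t pi t * f t <=
    (1 - a / n%:R) ^+ m * n%:R + m%:R * \sum_(s | bad s) pi s.
  move=> flip; rewrite -(gibbs_iter_stationary f m n0) -gibbs_bad_time//.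
  have E c : c = \sum_t pi t * c by rewrite -mulr_suml sum_gibbs// mul1r.
  rewrite [X in X - _]E [X in _ <= X + _]E.
  rewrite -sumrB -big_split /=; apply: ler_sum => t _.
  rewrite -mulrBr -mulrDr ler_wpM2l ?gibbs_ge0//.
  apply: (le_trans (glauber_iter_contraction m s t n0 a01 contr flip)).
  rewrite lerD2r ler_wpM2l ?hamming_le//; apply: exprn_ge0; rewrite subr_ge0.
  case/andP: a01 => _ a1; rewrite ler_pdivrMr ?ltr0n// mul1r (le_trans a1)//.
  by rewrite ler1n.
have [s0] : exists s0 : config q n, True by exists [ffun=> Ordinal q0].
(* The maxima defining the distances start from 0, so the bound must be nonnegative; the test
   function 0 shows it. *)
move=> _; have R0 : 0 <= (1 - a / n%:R) ^+ m * n%:R + m%:R * \sum_(s | bad s) pi s.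
  apply: le_trans (key (fun=> 0) s0 _) => [|s t]; last by rewrite subrr hamming_ge0.
  by under eq_bigr do rewrite mulr0;
    under [X in _ - X]eq_bigr do rewrite mulr0; rewrite !big1// subrr.
apply: bigmax_le => // s _; apply: bigmax_le => // A _.
have indE (g : config q n -> R) : \sum_(x in A) g x = \sum_x g x * (x \in A)%:R.
  by rewrite big_mkcond; apply: eq_bigr => x _; case: (x \in A); rewrite ?mulr1 ?mulr0.
have ind_lip s' t' : `|(s' \in A)%:R - (t' \in A)%:R| <= hamming R s' t'.
  have [->|st] := eqVneq s' t'; first by rewrite subrr normr0 hamming_ge0.
  apply: le_trans (hamming_ge1 R st).
  by case: (s' \in A); case: (t' \in A); rewrite ?subrr ?normr0 ?subr0 ?sub0r ?normrN ?normr1.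
rewrite !indE ler_norml; apply/andP; split; last first.
  by apply: key => s' t'; apply: le_trans (ind_lip s' t'); rewrite ler_norm.
(* The other sign of the absolute value comes from minus the indicator. *)
rewrite lerNl opprB.
have := key (fun x => - (x \in A)%:R) s.
under eq_bigr do rewrite mulrN.
under [X in _ - X]eq_bigr do rewrite mulrN.
rewrite !sumrN opprK addrC; apply => s' t'.
by apply: le_trans (ind_lip s' t'); rewrite distrC opprK addrC ler_norm.
Qed.

End GlauberOperator.

(** * The softmax map *)

(** The lower bound is [1 + u <= expR u]; applied to [- u], the same inequality gives
    [expR u * (1 - u) <= 1] and hence the upper one. *)
Lemma expR_sub1_sub_le (R : realType) (u : R) : `|u| <= 1 / 2 ->
  `|expR u - 1 - u| <= 2 * `|u| ^+ 2.
Proof.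
rewrite ler_norml => /andP[u1 u2]; rewrite real_normK ?num_real//.
have h1 := expR_ge1Dx u; have h2 := expR_ge1Dx (- u).
have e0 := expR_gt0 u.
have E : expR u * expR (- u) = 1 by rewrite -expRD subrr expR0.
have h3 : expR u * (1 - u) <= 1 by rewrite -[leRHS]E ler_wpM2l// ltW.
rewrite ger0_norm; last by lra.
have h4 : expR u * (1 - u) <= (1 + u + 2 * u ^+ 2) * (1 - u).
  by apply: (le_trans h3); nra.
have : 0 < 1 - u by lra.
by move=> u0; move: h4; rewrite ler_pM2r//; lra.
Qed.

Lemma expR_sub1_le (R : realType) (u : R) : `|u| <= 1 / 2 ->
  `|expR u - 1| <= 2 * `|u|.
Proof.
move=> u2; have := expR_sub1_sub_le u2; have := ler_normD (expR u - 1 - u) u.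
by rewrite subrK; have := normr_ge0 u; nra.
Qed.

Section Softmax.
Context (R : realType) (q : nat).
Implicit Types th c v : 'I_q -> R.

Definition softmax th k := expR (th k) / \sum_j expR (th j).

(** The derivative of [softmax] at [th] in the direction [v]. *)
Definition dsoftmax th v k := softmax th k * (v k - \sum_j softmax th j * v j).

Lemma sum_expR_gt0 th (k : 'I_q) : 0 < \sum_j expR (th j).
Proof.
by rewrite (bigD1 k) //= ltr_wpDr ?expR_gt0 ?sumr_ge0// => *; exact: expR_ge0.
Qed.

Lemma softmax_gt0 th k : 0 < softmax th k.
Proof. by rewrite divr_gt0 ?expR_gt0// sum_expR_gt0. Qed.

Lemma softmax_ge0 th k : 0 <= softmax th k. Proof. exact/ltW/softmax_gt0. Qed.

Lemma sum_softmax th : (0 < q)%N -> \sum_k softmax th k = 1.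
Proof.
by move=> q0; rewrite -mulr_suml divff// gt_eqF// (sum_expR_gt0 _ (Ordinal q0)).
Qed.

Lemma softmax_le1 th k : softmax th k <= 1.
Proof.
by rewrite ler_pdivrMr ?sum_expR_gt0// mul1r (bigD1 k) //= lerDl sumr_ge0// => *; exact: expR_ge0.
Qed.

(** An exact finite version of [dsoftmax]: the increments enter through [expR] minus 1, and the two
    occurrences of the outer weight are taken at the two different points. *)
Lemma softmax_sub th th' k :
  softmax th k - softmax th' k =
  softmax th' k * (expR (th k - th' k) - 1)
  - softmax th k * \sum_j softmax th' j * (expR (th j - th' j) - 1).
Proof.
have W0 := gt_eqF (sum_expR_gt0 th k); have W'0 := gt_eqF (sum_expR_gt0 th' k).
have E j : softmax th' j * (expR (th j - th' j) - 1) =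
    expR (th j) / (\sum_l expR (th' l)) - softmax th' j.
  by rewrite mulrBr mulr1 expRD expRN /softmax; field; rewrite W'0 gt_eqF// expR_gt0.
have q0 : (0 < q)%N by exact: leq_ltn_trans (ltn_ord k).
rewrite (eq_bigr _ (fun j _ => E j)) sumrB E -mulr_suml sum_softmax//.
by rewrite /softmax; field; rewrite W0 W'0.
Qed.

Lemma softmax_lipschitz th th' (r : R) : (0 < q)%N -> r <= 1 / 2 ->
  (forall k, `|th k - th' k| <= r) ->
  \sum_k `|softmax th k - softmax th' k| <= 4 * r.
Proof.
move=> q0 r2 thr.
have x2 j : `|expR (th j - th' j) - 1| <= 2 * r.
  apply: le_trans (expR_sub1_le (le_trans (thr j) r2)) _.
  by rewrite ler_wpM2l.
have S : \sum_j softmax th' j * `|expR (th j - th' j) - 1| <= 2 * r.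
  rewrite [leRHS](_ : _ = \sum_j softmax th' j * (2 * r)); last first.
    by rewrite -mulr_suml sum_softmax// mul1r.
  by apply: ler_sum => j _; rewrite ler_wpM2l ?softmax_ge0.
have B k : `|softmax th k - softmax th' k| <=
    softmax th' k * `|expR (th k - th' k) - 1| + softmax th k * (2 * r).
  rewrite softmax_sub; apply: (le_trans (ler_normB _ _)).
  rewrite (normrM (softmax th' k)) (normrM (softmax th k)).
  rewrite !(ger0_norm (softmax_ge0 _ _)) lerD2l; apply: ler_wpM2l; first exact: softmax_ge0.
  apply: le_trans S; apply: (le_trans (ler_norm_sum _ _ _)).
  by apply: ler_sum => j _; rewrite normrM ger0_norm ?softmax_ge0.
apply: (le_trans (ler_sum _ (fun k _ => B k))).
by rewrite big_split /= -mulr_suml sum_softmax//; lra.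
Qed.

Lemma norm_prod_sub_le (a b x y : R) : 0 <= a ->
  `|a * x - b * y| <= a * `|x - y| + `|a - b| * `|y|.
Proof.
move=> a0; have -> : a * x - b * y = a * (x - y) + (a - b) * y by ring.
by apply: (le_trans (ler_normD _ _)); rewrite !normrM (ger0_norm a0).
Qed.

(** Strict differentiability: the error is measured against [v], uniformly in two points near [th0].
    In [softmax_sub] the weights are close to those at [th0] and the exponential increments are
    close to [c k * v k]. *)
Lemma softmax_strict_derivative th0 c (eta : R) : (0 < q)%N -> 0 < eta ->
  exists2 r, 0 < r & forall th th' v,
    (forall k, `|th k - th0 k| <= r) -> (forall k, `|th' k - th0 k| <= r) ->
    (forall k, `|th k - th' k - c k * v k| <= r * `|v k|) ->
    \sum_k `|softmax th k - softmax th' k - dsoftmax th0 (fun j => c j * v j) k|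
      <= eta * \sum_k `|v k|.
Proof.
move=> q0 eta0.
pose C := \sum_k `|c k|; have C0 : 0 <= C by apply: sumr_ge0.
have cC k : `|c k| <= C by rewrite /C (bigD1 k) //= lerDl sumr_ge0.
(* The errors below add up to [r * (10 + 20 * C)] times the norm of [v]; the summand [4 * eta]
   forces [r <= 1 / 4], as the exponential estimates require. *)
pose D := 10 + 20 * C + 4 * eta; have D0 : 0 < D by rewrite /D; lra.
pose r := eta / D.
have rD : r * D = eta by rewrite /r divfK// gt_eqF.
have r0 : 0 < r by rewrite divr_gt0.
have r4 : r <= 1 / 4 by rewrite /r ler_pdivrMr// /D; lra.
exists r => // th th' v hth hth' huv.
set S := softmax th; set S' := softmax th'; set S0 := softmax th0.
have SS0 : \sum_k `|S k - S0 k| <= 4 * r by apply: softmax_lipschitz => //; lra.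
have S'S0 : \sum_k `|S' k - S0 k| <= 4 * r by apply: softmax_lipschitz => //; lra.
have S'S0k k : `|S' k - S0 k| <= 4 * r.
  by apply: le_trans S'S0; rewrite (bigD1 k) //= lerDl sumr_ge0.
pose u k := th k - th' k; pose x k := expR (u k) - 1; pose y k := c k * v k.
have yv k : `|y k| <= C * `|v k| by rewrite normrM ler_wpM2r.
have u2r k : `|u k| <= 2 * r.
  rewrite /u (_ : th k - th' k = (th k - th0 k) - (th' k - th0 k)); last by ring.
  by apply: (le_trans (ler_normB _ _)); have := hth k; have := hth' k; lra.
have uv k : `|u k| <= (C + 1) * `|v k|.
  rewrite -(subrK (y k) (u k)); apply: (le_trans (ler_normD _ _)).
  have := huv k; have := yv k; rewrite -/(u k) -/(y k).
  have : r * `|v k| <= 1 * `|v k| by rewrite ler_wpM2r//; lra.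
  by lra.
have xy k : `|x k - y k| <= r * (5 + 4 * C) * `|v k|.
  rewrite (_ : x k - y k = (x k - u k) + (u k - y k)); last by ring.
  apply: (le_trans (ler_normD _ _)).
  have h1 : `|x k - u k| <= 2 * `|u k| ^+ 2.
    by apply: expR_sub1_sub_le; have := u2r k; lra.
  have h2 := huv k; rewrite -/(u k) -/(y k) in h2.
  have h3 : `|u k| ^+ 2 <= (2 * r) * ((C + 1) * `|v k|).
    by rewrite expr2 ler_pM.
  lra.
have b1 k : `|S' k * x k - S0 k * y k| <= r * (5 + 8 * C) * `|v k|.
  apply: (le_trans (norm_prod_sub_le _ _ _ (softmax_ge0 _ _))).
  have h1 : S' k * `|x k - y k| <= 1 * (r * (5 + 4 * C) * `|v k|).
    by apply: ler_pM; rewrite ?softmax_ge0 ?softmax_le1.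
  have h2 : `|S' k - S0 k| * `|y k| <= 4 * r * (C * `|v k|) by apply: ler_pM.
  by rewrite -/S'; lra.
set V := \sum_k `|v k|.
have V0 : 0 <= V by apply: sumr_ge0.
have b2 : `|\sum_j S' j * x j - \sum_j S0 j * y j| <= r * (5 + 8 * C) * V.
  rewrite -sumrB mulr_sumr; apply: (le_trans (ler_norm_sum _ _ _)).
  by apply: ler_sum => k _; exact: b1.
have b3 : `|\sum_j S0 j * y j| <= C * V.
  rewrite mulr_sumr; apply: (le_trans (ler_norm_sum _ _ _)).
  apply: ler_sum => k _; rewrite normrM -[leRHS]mul1r; apply: ler_pM => //.
  by rewrite ger0_norm ?softmax_ge0 ?softmax_le1.
have b4 k : `|S k - S' k - dsoftmax th0 y k| <=
    r * (5 + 8 * C) * `|v k| + (S k * (r * (5 + 8 * C) * V) + `|S k - S0 k| * (C * V)).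
  rewrite /S /S' softmax_sub -/S -/S' /dsoftmax -/S0.
  rewrite (_ : _ - _ = (S' k * x k - S0 k * y k)
     - (S k * (\sum_j S' j * x j) - S0 k * \sum_j S0 j * y j)); last by rewrite /x /u; ring.
  apply: (le_trans (ler_normB _ _)); apply: lerD => //.
  apply: (le_trans (norm_prod_sub_le _ _ _ (softmax_ge0 _ _))).
  by apply: lerD; apply: ler_pM => //; rewrite softmax_ge0.
apply: (le_trans (ler_sum _ (fun k _ => b4 k))).
have S1 : \sum_k S k = 1 by exact: sum_softmax.
have SX X : \sum_k S k * X = X by rewrite -mulr_suml S1 mul1r.
rewrite !big_split /= -mulr_sumr SX -/V -[X in _ + (_ + X)]mulr_suml.
have h : (\sum_k `|S k - S0 k|) * (C * V) <= 4 * r * (C * V).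
  by rewrite ler_wpM2r// mulr_ge0.
have h2 : 0 <= r * eta * V by apply: mulr_ge0 => //; apply: mulr_ge0; exact: ltW.
have -> : eta * V = r * (10 + 20 * C + 4 * eta) * V by rewrite -{1}rD.
lra.
Qed.

End Softmax.

(** * Difference quotients of functions of one variable *)

Section OneVariable.
Context (R : realType).

Lemma derive_MVT (u u1 : R -> R) (a b : R) : (forall x : R, is_derive x 1 u (u1 x)) -> a <= b ->
  exists2 c, a <= c <= b & u b - u a = u1 c * (b - a).
Proof.
move=> du ab; have [|c cab ->] := MVT_segment ab (fun x _ => du x).
  apply: continuous_subspaceT => x.
  by apply/differentiable_continuous/derivable1_diffP; case: (du x).
by exists c => //; move: cab; rewrite in_itv.
Qed.

Lemma lipschitz_of_derive_bound (u u1 : R -> R) (a b M : R) :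
  (forall x : R, is_derive x 1 u (u1 x)) ->
  (forall x, a <= x <= b -> `|u1 x| <= M) ->
  forall x y, a <= x <= b -> a <= y <= b -> `|u x - u y| <= M * `|x - y|.
Proof.
move=> du bnd x y; wlog xy : x y / x <= y => [hw|] hx hy.
  have [xy|/ltW xy] := leP x y; first exact: hw.
  by rewrite distrC (distrC x); exact: hw.
have [c cxy E] := derive_MVT du xy.
rewrite distrC E normrM (distrC x) ler_wpM2r// bnd//; lra.
Qed.

Lemma continuous_eps (u : R -> R) (x0 eta : R) : {for x0, continuous u} -> 0 < eta ->
  exists2 r, 0 < r & forall x, `|x - x0| <= r -> `|u x - u x0| <= eta.
Proof.
move=> /cvgrPdist_le cu eta0; have /nbhs_ballP[r /= r0 hr] := cu _ eta0.
exists (r / 2); first by rewrite divr_gt0.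
move=> x xr; rewrite distrC; apply: hr; rewrite /ball /= distrC.
by apply: le_lt_trans xr _; rewrite ltr_pdivrMr//; lra.
Qed.

(** With [e = 1/n] it takes the place of the derivative of the energy when a single spin is
    updated. *)
Definition diff_quot (u : R -> R) (e x : R) : R := e^-1 * (u (x + e) - u x).

Lemma diff_quot_derive (u u1 : R -> R) (e x : R) : (forall x : R, is_derive x 1 u (u1 x)) ->
  is_derive x 1 (diff_quot u e) (e^-1 * (u1 (x + e) - u1 x)).
Proof.
move=> du; have d1 : is_derive x 1 (u \o shift e) (u1 (x + e) * 1).
  exact: (@is_derive1_comp _ u (shift e) x _ 1 (du _) (is_derive_shift x 1 e)).
rewrite mulr1 in d1; have d2 := is_deriveZ e^-1 (is_deriveB d1 (du x)).
exact: d2.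
Qed.

(** By the mean value theorem the quotient is a value of [u1], and its derivative a value of [u2],
    at a point within [e]. Continuity of [u1] and [u2] at [x0] thus gives bounds uniform in [e]. *)
Lemma diff_quot_strict_derivative (u u1 u2 : R -> R) (x0 eta : R) :
  (forall x : R, is_derive x 1 u (u1 x)) -> (forall x : R, is_derive x 1 u1 (u2 x)) ->
  {for x0, continuous u2} -> 0 < eta ->
  exists2 r, 0 < r & forall e x y, 0 < e <= r -> `|x - x0| <= r -> `|y - x0| <= r ->
    [/\ `|diff_quot u e x - u1 x0| <= eta,
        `|u1 x - u1 x0| <= eta,
        `|diff_quot u e x - diff_quot u e y - u2 x0 * (x - y)| <= eta * `|x - y| &
        `|u1 x - u1 y - u2 x0 * (x - y)| <= eta * `|x - y|].
Proof.
move=> du du1 cu2 eta0.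
have cu1 : {for x0, continuous u1}.
  by apply/differentiable_continuous/derivable1_diffP; case: (du1 x0).
have [r1 r10 h1] := continuous_eps cu1 eta0.
have [r2 r20 h2] := continuous_eps cu2 eta0.
(* Halving leaves room for a step [e <= r] from a point within [r] of [x0]. *)
pose r := Num.min r1 r2 / 2.
have r0 : 0 < r by rewrite divr_gt0// lt_min r10 r20.
have rr1 : 2 * r <= r1 by rewrite /r mulrC divfK// ge_min lexx.
have rr2 : 2 * r <= r2 by rewrite /r mulrC divfK// ge_min lexx orbT.
exists r => // e x y /andP[e0 er] hx hy.
have key : forall v v1 : R -> R, (forall x : R, is_derive x 1 v (v1 x)) ->
    (forall c, `|c - x0| <= r -> `|v1 c - u2 x0| <= eta) ->
    forall x y, `|x - x0| <= r -> `|y - x0| <= r ->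
    `|v x - v y - u2 x0 * (x - y)| <= eta * `|x - y|.
  move=> v v1 dv hv x' y'; wlog xy : x' y' / y' <= x' => [hw|] hx' hy'.
    have [xy|/ltW xy] := leP y' x'; first exact: hw.
    have -> : v x' - v y' - u2 x0 * (x' - y') = - (v y' - v x' - u2 x0 * (y' - x')).
      by ring.
    by rewrite normrN (distrC x'); exact: hw.
  have [c /andP[c1 c2] ->] := derive_MVT dv xy.
  rewrite -mulrBl normrM ler_wpM2r// hv//.
  move: hx' hy'; rewrite !ler_norml => /andP[? ?] /andP[? ?].
  by apply/andP; split; lra.
split.
- have xe : x <= x + e by rewrite lerDl ltW.
  have [c /andP[c1 c2]] := derive_MVT du xe.
  rewrite /diff_quot => ->; rewrite (addrC x) addrK mulrCA mulVf ?gt_eqF// mulr1.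
  apply: h1; move: hx; rewrite !ler_norml => /andP[? ?].
  by apply/andP; split; lra.
- by apply: h1; lra.
- apply: (key _ _ (fun x => diff_quot_derive e x du)) => // c hc.
  have ce : c <= c + e by rewrite lerDl ltW.
  have [d /andP[d1 d2] ->] := derive_MVT du1 ce.
  rewrite (addrC c) addrK mulrCA mulVf ?gt_eqF// mulr1.
  apply: h2; move: hc; rewrite !ler_norml => /andP[? ?].
  by apply/andP; split; lra.
- by apply: (key _ _ du1) => // c hc; apply: h2; lra.
Qed.

(** [M] is the maximum of the absolute value of [u2] on [0, 1], a Lipschitz constant of [u1] there;
    the quotient is [u1] at a point between [x] and [x + e]. *)
Lemma diff_quot_uniform (u u1 u2 : R -> R) :
  (forall x : R, is_derive x 1 u (u1 x)) -> (forall x : R, is_derive x 1 u1 (u2 x)) ->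
  continuous u2 ->
  exists2 M, 0 <= M & forall e x y, 0 < e -> 0 <= x -> x + e <= 1 -> 0 <= y <= 1 ->
    `|diff_quot u e x - u1 y| <= M * (`|x - y| + e).
Proof.
move=> du du1 cu2.
have cabs : {within `[0, 1], continuous (fun x : R => `|u2 x|)}.
  apply: continuous_subspaceT => x; exact: continuous_comp (cu2 x) (@norm_continuous _ R^o (u2 x)).
have [c _ hc] := EVT_max ler01 cabs.
exists `|u2 c| => // e x y e0 x0 xe1 y01.
have xe : x <= x + e by rewrite lerDl ltW.
have [d /andP[d1 d2]] := derive_MVT du xe.
rewrite /diff_quot => ->; rewrite (addrC x) addrK mulrCA mulVf ?gt_eqF// mulr1.
have bnd z : 0 <= z <= 1 -> `|u2 z| <= `|u2 c| by move=> z01; apply: hc; rewrite in_itv.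
have d01 : 0 <= d <= 1 by apply/andP; split; lra.
apply: le_trans (lipschitz_of_derive_bound du1 bnd d01 y01) _; apply: ler_wpM2l => //.
have -> : d - y = (x - y) + (d - x) by ring.
apply: (le_trans (ler_normD _ _)); rewrite lerD2l ger0_norm; lra.
Qed.

Lemma concave_tangent (u u1 : R -> R) (a b : R) : (forall x : R, is_derive x 1 u (u1 x)) ->
  {for a, continuous u1} ->
  (forall t, 0 <= t <= 1 -> (1 - t) * u a + t * u b <= u ((1 - t) * a + t * b)) ->
  u b <= u a + u1 a * (b - a).
Proof.
move=> du cu1 conc; rewrite -lerBlDl; apply/ler_addgt0Pr => eta eta0.
pose D := `|b - a| + 1; have D0 : 0 < D by rewrite ltr_wpDl.
have [r r0 hr] := continuous_eps cu1 (divr_gt0 eta0 D0).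
(* So small that the point at parameter [t] stays within [r] of [a], where [u1] varies by at most
   [eta / D]. *)
pose t := Num.min 1 (r / D).
have t0 : 0 < t by rewrite lt_min ltr01 divr_gt0.
have t1 : t <= 1 by rewrite ge_min lexx.
have tD : t * D <= r by rewrite -ler_pdivlMr// ge_min lexx orbT.
have [c [cr E]] : exists c, `|c - a| <= r /\
    u ((1 - t) * a + t * b) - u a = u1 c * (t * (b - a)).
  set d := (1 - t) * a + t * b; have dE : d - a = t * (b - a) by rewrite /d; ring.
  have dr : `|d - a| <= r.
    rewrite dE normrM gtr0_norm//; apply: le_trans tD.
    by rewrite ler_pM2l// lerDl.
  rewrite -dE; have [ad|/ltW da] := leP a d.
    have [c /andP[c1 c2] ->] := derive_MVT du ad; exists c; split => //.
    move: dr; rewrite ger0_norm ?subr_ge0//; rewrite ger0_norm ?subr_ge0//; lra.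
  have [c /andP[c1 c2] E] := derive_MVT du da; exists c; split.
    move: dr; rewrite ler0_norm ?subr_le0//; rewrite ler0_norm ?subr_le0//; lra.
  by rewrite -opprB E; ring.
have := conc t; rewrite t1 ltW// => /(_ isT) conct.
have h1 : t * (u b - u a) <= t * (u1 c * (b - a)) by lra.
rewrite ler_pM2l// in h1; apply: (le_trans h1).
rewrite -lerBlDl -mulrBl; apply: (le_trans (ler_norm _)); rewrite normrM.
have -> : eta = eta / D * D by rewrite divfK// gt_eqF.
by apply: ler_pM => //; [exact: hr|rewrite lerDl].
Qed.

End OneVariable.

(** * Separable energies *)

Section Separable.
Context (R : realType) (q : nat).

(** Along the k-th axis the difference quotients of [f] and [u] are the same functions. It serves
    for [H] and again for its first partial derivatives. *)
Lemma partial_coordinate (f : 'rV[R]_q -> R) (k : 'I_q) (u : R -> R) :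
  (forall z t, f (t *: delta_mx 0 k + z) - f z = u (t + z 0 k) - u (z 0 k)) ->
  (forall z, derivable f z (delta_mx 0 k)) ->
  (forall x : R, is_derive x 1 u ('D_1 u x)) /\
  (forall z, partial k f z = 'D_1 u (z 0 k)).
Proof.
move=> fu df.
have E z : (fun h => h^-1 *: ((f \o shift z) (h *: delta_mx 0 k) - f z)) =
    (fun h : R => h^-1 *: ((u \o shift (z 0 k)) (h *: (1 : R)) - u (z 0 k))).
  by apply/funext => h /=; rewrite /shift /= fu scaler1.
have dE z : derivable f z (delta_mx 0 k) = derivable u (z 0 k) 1.
  by rewrite /derivable E.
split => [x|z]; last by rewrite /partial /derive E.
split => //; have := df (const_mx x); by rewrite dE mxE.
Qed.

Lemma separable_shift (h : 'I_q -> R -> R) k z t :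
  \sum_j h j ((t *: delta_mx 0 k + z : 'rV[R]_q) 0 j) - \sum_j h j (z 0 j) =
  h k (t + z 0 k) - h k (z 0 k).
Proof.
rewrite -sumrB (bigD1 k) //= !mxE !eqxx mulr1 big1 ?addr0// => j /negPf jk.
by rewrite !mxE jk andbF mulr0 add0r subrr.
Qed.

Lemma separable_C2 (H : 'rV[R]_q -> R) : class_C 3 H -> separable H ->
  exists h h1 h2 : 'I_q -> R -> R,
    [/\ forall z, H z = \sum_k h k (z 0 k),
        forall k (x : R), is_derive x 1 (h k) (h1 k x),
        forall k (x : R), is_derive x 1 (h1 k) (h2 k x),
        forall k, continuous (h2 k) &
        forall k z, partial k H z = h1 k (z 0 k)].
Proof.
move=> [_ C3] [h hE].
exists h, (fun k x => 'D_1 (h k) x), (fun k x => 'D_1 (fun y : R => 'D_1 (h k) y) x).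
have p1 k : (forall x : R, is_derive x 1 (h k) ('D_1 (h k) x)) /\
    (forall z, partial k H z = 'D_1 (h k) (z 0 k)).
  apply: partial_coordinate => [z t|]; last exact: (C3 k).1.
  by rewrite !hE separable_shift.
have p2 k : (forall x : R, is_derive x 1 (fun y : R => 'D_1 (h k) y)
      ('D_1 (fun y : R => 'D_1 (h k) y) x)) /\
    (forall z, partial k (partial k H) z = 'D_1 (fun y : R => 'D_1 (h k) y) (z 0 k)).
  have [_ [_ /(_ k) [d2 _]]] := C3 k.
  apply: partial_coordinate => // z t.
  by rewrite !(p1 k).2 !mxE !eqxx mulr1.
split => // [k|k|k|k].
- exact: (p1 k).1.
- exact: (p2 k).1.
- have [_ [_ /(_ k) [_ [c2 _]]]] := C3 k.
  (* The second derivative of [h k] is a second partial derivative of [H] restricted to the k-th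
     axis, and inherits its continuity. *)
  have -> : 'D_1 (fun y : R => 'D_1 (h k) y) =
      (partial k (partial k H)) \o (fun x : R => x *: (delta_mx 0 k : 'rV[R]_q)).
    by apply/funext => x /=; rewrite (p2 k).2 !mxE !eqxx mulr1.
  move=> x; apply: continuous_comp; last exact: c2.
  exact: scalel_continuous.
- exact: (p1 k).2.
Qed.

(** On the k-th axis the other summands of [H] are constant, so they cancel from the concavity
    inequality. *)
Lemma concave_coordinate (H : 'rV[R]_q -> R) (h : 'I_q -> R -> R) k :
  concave H -> (forall z, H z = \sum_k h k (z 0 k)) ->
  forall a b t, 0 <= t <= 1 ->
  (1 - t) * h k a + t * h k b <= h k ((1 - t) * a + t * b).
Proof.
move=> cH hE a b t /andP[t0 t1].
pose e (x : R) : 'rV[R]_q := x *: delta_mx 0 k.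
have He x : H (e x) = h k x + \sum_(j | j != k) h j 0.
  rewrite hE (bigD1 k) //= !mxE !eqxx mulr1; congr (_ + _).
  by apply: eq_bigr => j /negPf jk; rewrite !mxE jk andbF mulr0.
have := cH (Itv01 t0 t1) (e b) (e a).
rewrite !inE => /(_ I I).
change (- H (t *: e b + (1 - t) *: e a) <= t * (- H (e b)) + (1 - t) * (- H (e a)) ->
  (1 - t) * h k a + t * h k b <= h k ((1 - t) * a + t * b)).
have -> : t *: e b + (1 - t) *: e a = e ((1 - t) * a + t * b).
  by rewrite /e !scalerA -scalerDl addrC.
by rewrite !He; lra.
Qed.

Lemma separable_concave_tangent (H : 'rV[R]_q -> R) (h h1 : 'I_q -> R -> R) :
  concave H -> (forall z, H z = \sum_k h k (z 0 k)) ->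
  (forall k (x : R), is_derive x 1 (h k) (h1 k x)) ->
  (forall k, continuous (h1 k)) ->
  forall x y, H y <= H x + \sum_k h1 k (x 0 k) * (y 0 k - x 0 k).
Proof.
move=> cH hE dh ch x y; rewrite !hE -big_split /=; apply: ler_sum => k _.
apply: concave_tangent => //; first exact: ch.
exact: concave_coordinate cH hE _ _.
Qed.

End Separable.

(** * Magnetization and update probabilities *)

Lemma common_radius (R : realType) (q : nat) (P : 'I_q -> R -> Prop) :
  (forall k, exists2 r, 0 < r & P k r) ->
  (forall k r r', 0 < r' -> r' <= r -> P k r -> P k r') ->
  exists2 r, 0 < r & forall k, P k r.
Proof.
move=> ex mono.
have /choice[f hf] : forall k, exists r, 0 < r /\ P k r.
  by move=> k; have [r r0 Pr] := ex k; exists r.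
(* Below every [f k], and positive also when there is no index. *)
exists (1 / (1 + \sum_k (f k)^-1)).
  rewrite divr_gt0// ltr_wpDr// sumr_ge0// => k _; rewrite invr_ge0 ltW//.
  exact: (hf k).1.
move=> k; have [fk Pk] := hf k; have fk' : 0 < (f k)^-1 by rewrite invr_gt0.
have S0 : 0 < 1 + \sum_k (f k)^-1.
  by rewrite ltr_wpDr// sumr_ge0// => j _; rewrite invr_ge0 ltW// (hf j).1.
apply: (mono _ (f k)) => //; first by rewrite divr_gt0.
rewrite ler_pdivrMr// -ler_pdivrMl// mulr1 (bigD1 k) //= addrCA lerDl.
rewrite addr_ge0// sumr_ge0// => j _; rewrite invr_ge0 ltW// (hf j).1//.
Qed.

Section Magnetization.
Context (R : realType) (q n : nat).
Implicit Types (s t : config q n).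

(** Normalized by [n] although one site is left out, so that a spin placed at [i] raises one
    coordinate by exactly 1/n. *)
Definition off_magnetization s (i : 'I_n) (k : 'I_q) : R :=
  (\sum_(j < n | j != i) (s j == k)%:R) / n%:R.

Local Notation off := off_magnetization.
Local Notation mag := (@magnetization R q n).

Lemma magnetizationE s k : mag s 0 k = (\sum_(j < n) (s j == k)%:R) / n%:R.
Proof.
rewrite mxE -sum1_card natr_sum big_mkcond /=; congr (_ / _).
by apply: eq_bigr => j _; rewrite inE; case: (s j == k).
Qed.

Lemma magnetization_off s i k : mag s 0 k = off s i k + (s i == k)%:R / n%:R.
Proof. by rewrite magnetizationE (bigD1 i) //= mulrDl addrC. Qed.

Lemma off_set_spin s i k : off (set_spin s i k) i =1 off s i.
Proof.
move=> l; rewrite /off; congr (_ / _); apply: eq_bigr => j /negPf ji.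
by rewrite ffunE ji.
Qed.

Lemma magnetization_set_spin s i k l :
  mag (set_spin s i k) 0 l = off s i l + (k == l)%:R / n%:R.
Proof. by rewrite (magnetization_off _ i) off_set_spin set_spin_at. Qed.

Lemma off_ge0 s i k : 0 <= off s i k.
Proof. by rewrite divr_ge0// sumr_ge0// => j _; rewrite ler0n. Qed.

Lemma sum_magnetization s : (0 < n)%N -> \sum_k mag s 0 k = 1.
Proof.
move=> n0; under eq_bigr do rewrite magnetizationE.
rewrite -mulr_suml exchange_big /= (eq_bigr (fun=> 1)).
  by rewrite sumr_const card_ord divff// pnatr_eq0 -lt0n.
move=> j _; rewrite (bigD1 (s j)) //= eqxx big1 ?addr0// => k.
by rewrite eq_sym => /negPf ->.
Qed.

Lemma simplex_magnetization s : (0 < n)%N -> simplex (mag s).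
Proof.
move=> n0; split; last exact: sum_magnetization.
by move=> k; rewrite magnetizationE divr_ge0// sumr_ge0.
Qed.

Lemma simplex_le1 (z : 'rV[R]_q) k : simplex z -> z 0 k <= 1.
Proof. by move=> [z0 <-]; rewrite (bigD1 k) //= lerDl sumr_ge0. Qed.

Lemma off_le s i k : (0 < n)%N -> off s i k + n%:R^-1 <= 1.
Proof.
move=> n0; have := simplex_le1 k (simplex_magnetization (set_spin s i k) n0).
by rewrite magnetization_set_spin eqxx mul1r.
Qed.

Lemma sum_off_sub s t i : (0 < n)%N -> \sum_k (off s i k - off t i k) = 0.
Proof.
(* Giving both configurations the same spin at [i] turns the difference into one of
   magnetizations. *)
move=> n0; have E k : off s i k - off t i k =
    mag (set_spin s i (s i)) 0 k - mag (set_spin t i (s i)) 0 k.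
  by rewrite !magnetization_set_spin; ring.
by rewrite (eq_bigr _ (fun k _ => E k)) sumrB !sum_magnetization// subrr.
Qed.

Lemma sum_indicator_dist (a b : 'I_q) :
  \sum_k `|(a == k)%:R - (b == k)%:R| <= 2 * (a != b)%:R :> R.
Proof.
have [->|ab] := eqVneq a b.
  by rewrite mulr0 big1// => k _; rewrite subrr normr0.
rewrite mulr1; apply: le_trans (_ : \sum_k ((a == k)%:R + (b == k)%:R) <= _).
  apply: ler_sum => k _; apply: (le_trans (ler_normB _ _)).
  by rewrite !ger0_norm.
have one c : \sum_k (c == k)%:R = 1 :> R.
  rewrite (bigD1 c) //= eqxx big1 ?addr0// => k; rewrite eq_sym.
  by move=> /negPf ->.
by rewrite big_split /= !one.
Qed.

Lemma magnetization_dist s t :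
  \sum_k `|mag s 0 k - mag t 0 k| <= 2 * (hamming R s t / n%:R).
Proof.
rewrite mulrA ; under eq_bigr do rewrite !magnetizationE -mulrBl normrM -sumrB.
rewrite -mulr_suml ger0_norm ?invr_ge0// ler_wpM2r ?invr_ge0//.
apply: (@le_trans _ _ (\sum_(k < q) \sum_(j < n) `|(s j == k)%:R - (t j == k)%:R|)).
  by apply: ler_sum => k _; exact: ler_norm_sum.
rewrite exchange_big mulr_sumr /=; apply: ler_sum => j _.
exact: sum_indicator_dist.
Qed.

Lemma off_dist s t i :
  \sum_k `|off s i k - off t i k| <= 2 * (hamming R s t / n%:R).
Proof.
have E k : off s i k - off t i k =
    mag (set_spin s i (s i)) 0 k - mag (set_spin t i (s i)) 0 k.
  by rewrite !magnetization_set_spin; ring.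
under eq_bigr do rewrite E.
apply: (le_trans (magnetization_dist _ _)); rewrite hamming_set_spin eqxx addr0.
rewrite ler_wpM2l// ler_wpM2r ?invr_ge0// gerBl.
by rewrite ler0n.
Qed.

Lemma off_magnetization_dist s i k : `|off s i k - mag s 0 k| <= n%:R^-1.
Proof.
rewrite (magnetization_off s i) opprD addNKr normrN ger0_norm ?divr_ge0//.
by case: (s i == k); rewrite ?mul1r ?mul0r ?invr_ge0.
Qed.

(** Choosing spin [k] at [i] changes only the k-th summand of [H], so the factor [B] common to all
    choices cancels. What remains is the formula for g with derivatives replaced by difference
    quotients of step 1/n. *)
Lemma update_prob_softmax (H : 'rV[R]_q -> R) beta (h : 'I_q -> R -> R) :
  (0 < n)%N -> (forall z, H z = \sum_k h k (z 0 k)) -> forall s i k,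
  update_prob H beta s i k =
  softmax (fun l => - (beta * diff_quot (h l) n%:R^-1 (off s i l))) k.
Proof.
move=> n0 hE s i.
pose B := expR (- (beta * n%:R * \sum_l h l (off s i l))).
have E k : boltzmann H beta (set_spin s i k) =
    B * expR (- (beta * diff_quot (h k) n%:R^-1 (off s i k))).
  rewrite -expRD /boltzmann hE; congr expR.
  rewrite -opprD -!mulrA -mulrDr; congr (- (_ * _)).
  rewrite /diff_quot invrK -mulrDr; congr (_ * _).
  rewrite (bigD1 k) //= [in RHS](bigD1 k) //= magnetization_set_spin eqxx mul1r.
  rewrite [X in _ + X](_ : _ = \sum_(l < q | l != k) h l (off s i l)); first by ring.
  apply: eq_bigr => l; rewrite eq_sym magnetization_set_spin => /negPf ->.
  by rewrite mul0r addr0.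
move=> k; rewrite /update_prob /softmax E; under eq_bigr do rewrite E.
rewrite -mulr_sumr; field.
by rewrite !gt_eqF ?expR_gt0// (sum_expR_gt0 _ k).
Qed.

End Magnetization.

Lemma g_coord_softmax (R : realType) (q : nat) (H : 'rV[R]_q -> R) beta
    (h1 : 'I_q -> R -> R) :
  (forall k z, partial k H z = h1 k (z 0 k)) -> forall k z,
  g_coord H beta k z = softmax (fun l => - (beta * h1 l (z 0 l))) k.
Proof.
move=> pE k z; rewrite /g_coord /softmax pE; congr (_ / _).
by apply: eq_bigr => l _; rewrite pE.
Qed.

Lemma uniform_condition_g_dist (R : realType) (q : nat) (H : 'rV[R]_q -> R) beta zb delta :
  uniform_condition H beta zb delta -> forall z, simplex z ->
  \sum_k `|g_coord H beta k z - g_coord H beta k zb| <= (1 - delta) * norm1 (z - zb).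
Proof.
move=> [_ U] z sz; have [->|zzb] := eqVneq z zb.
  rewrite subrr /norm1 !big1 ?mulr0// => k _; last by rewrite subrr normr0.
  by rewrite mxE normr0.
have N0 : 0 < norm1 (z - zb).
  rewrite lt_def sumr_ge0// andbT; apply: contra zzb => /eqP N.
  apply/eqP/rowP => k; apply/eqP; rewrite -subr_eq0 -normr_eq0.
  have := N; rewrite /norm1 => /eqP; rewrite psumr_eq0// => /allP/(_ k).
  by rewrite mem_index_enum !mxE => /(_ isT).
rewrite -ler_pdivrMr// -lee_fin; apply: le_trans (U z sz zzb).
rewrite EFinM lee_wpmul2r ?lee_fin ?invr_ge0 ?(ltW N0)//.
(* Along every admissible path the total variation of each [g_coord] is at least the difference of
   its end values, so the infimum is too. *)
apply/ereal_infP => _ [rho [crho r0 r1 _ _] <-].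
rewrite -sumEFin; apply: lee_sum => k _.
have [e0 e1] : g_coord H beta k (rho 0) = g_coord H beta k z /\
    g_coord H beta k (rho 1) = g_coord H beta k zb by rewrite r0 r1.
rewrite -e0 -e1 distrC.
exact: (@total_variation_ge R 0 1 (fun t => g_coord H beta k (rho t)) ler01).
Qed.

(** * Contraction of the update probabilities *)

Section Contraction.
Context (R : realType) (q : nat).
Variables (h h1 h2 : 'I_q -> R -> R) (beta delta : R) (zb : 'rV[R]_q).
Hypotheses (beta0 : 0 < beta) (delta01 : 0 < delta < 1).
Hypotheses (dh : forall k (x : R), is_derive x 1 (h k) (h1 k x))
  (dh1 : forall k (x : R), is_derive x 1 (h1 k) (h2 k x))
  (ch2 : forall k, continuous (h2 k)).
Hypotheses (zb_simplex : simplex zb) (zb_gt0 : forall k, 0 < zb 0 k).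

Local Notation g z := (softmax (fun l => - (beta * h1 l (z l)))).
Local Notation p e y := (softmax (fun l => - (beta * diff_quot (h l) e (y l)))).
Local Notation b := (fun k => zb 0 k).

Hypothesis g_contraction : forall z : 'I_q -> R, (forall k, 0 <= z k) -> \sum_k z k = 1 ->
  \sum_k `|g z k - g b k| <= (1 - delta) * \sum_k `|z k - b k|.

Lemma simplex_dim_gt0 : (0 < q)%N.
Proof.
case: zb_simplex => _; case: (posnP q) => // q0.
rewrite big1 => [/eqP|k _]; first by rewrite eq_sym oner_eq0.
by have := ltn_ord k; rewrite {2}q0.
Qed.

Lemma dsoftmax_scale th (c : R) (v : 'I_q -> R) k :
  dsoftmax th (fun j => c * v j) k = c * dsoftmax th v k.
Proof.
rewrite /dsoftmax (_ : \sum_j softmax th j * (c * v j) = c * \sum_j softmax th j * v j).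
  by ring.
by rewrite mulr_sumr; apply: eq_bigr => j _; ring.
Qed.

Lemma sub_opp_mul (c x y : R) : - (c * x) - - (c * y) = - (c * (x - y)).
Proof. by ring. Qed.

(* Since [zb] is interior, the contraction of [g] towards [zb] bounds the
   derivative of [g] at [zb] along tangent vectors, and [p e] is strictly close
   to its linearization. *)
Lemma update_contraction_near :
  exists2 r, 0 < r & forall e (x y : 'I_q -> R), 0 < e <= r ->
    (forall k, `|x k - b k| <= r) -> (forall k, `|y k - b k| <= r) ->
    \sum_k (x k - y k) = 0 ->
    \sum_k `|p e x k - p e y k| <= (1 - delta / 2) * \sum_k `|x k - y k|.
Proof.
case/andP: delta01 => d0 d1; have q0 := simplex_dim_gt0.
(* The margin [delta / 4] is spent twice: from g to its derivative, leaving [1 - 3 * delta / 4], and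
   from the derivative to [p e], leaving [1 - delta / 2]. *)
have d4 : 0 < delta / 4 by lra.
pose th0 k := - (beta * h1 k (b k)); pose c k := - (beta * h2 k (b k)).
have [r0 r00 strict] := softmax_strict_derivative th0 c q0 d4.
(* The condition [r <= zb 0 k] keeps [zb] plus a small tangent vector in the simplex. *)
pose P k r := r <= zb 0 k /\ forall e x y, 0 < e <= r ->
    `|x - b k| <= r -> `|y - b k| <= r ->
    [/\ `|diff_quot (h k) e x - h1 k (b k)| <= r0 / beta,
        `|h1 k x - h1 k (b k)| <= r0 / beta,
        `|diff_quot (h k) e x - diff_quot (h k) e y - h2 k (b k) * (x - y)|
           <= r0 / beta * `|x - y| &
        `|h1 k x - h1 k y - h2 k (b k) * (x - y)| <= r0 / beta * `|x - y|].
have [|k r r' r'0 r'r [rz hr]|r rp rP] := @common_radius R q P.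
- move=> k; have [r rp hr] := diff_quot_strict_derivative (dh k) (dh1 k)
    (@ch2 k (b k)) (divr_gt0 r00 beta0).
  exists (Num.min r (zb 0 k)); first by rewrite lt_min rp zb_gt0.
  split; first by rewrite ge_min lexx orbT.
  move=> e x y; rewrite !le_min => /and3P[? ? _] /andP[? _] /andP[? _].
  by apply: hr => //; apply/andP.
- split; first exact: le_trans rz.
  move=> e x y /andP[e0 er] hx hy; apply: hr; last 2 first.
  + exact: le_trans r'r.
  + exact: le_trans r'r.
  + by rewrite e0 (le_trans er).
have scale (a u : R) : `|a| <= r0 / beta * u -> `|- (beta * a)| <= r0 * u.
  move=> au; rewrite normrN normrM gtr0_norm//.
  have -> : r0 * u = beta * (r0 / beta * u) by field; rewrite gt_eqF.
  by rewrite ler_pM2l.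
have scale1 (a : R) : `|a| <= r0 / beta -> `|- (beta * a)| <= r0.
  by have := scale a 1; rewrite !mulr1.
have tangent (v : 'I_q -> R) : (forall k, `|v k| <= r) -> \sum_k v k = 0 ->
    \sum_k `|dsoftmax th0 (fun j => c j * v j) k| <=
    (1 - 3 * delta / 4) * \sum_k `|v k|.
  move=> vr v0; pose z k := b k + v k.
  have zr k : `|z k - b k| <= r by rewrite /z addrC addKr.
  have b_r k : `|b k - b k| <= r by rewrite subrr normr0 ltW.
  have rr : 0 < r <= r by rewrite rp lexx.
  have S : \sum_k `|g z k - g b k - dsoftmax th0 (fun j => c j * v j) k| <=
      delta / 4 * \sum_k `|v k|.
    apply: strict => k; have [_ /(_ r (z k) (b k) rr (zr k) (b_r k))[_ H1 _ H2]] := rP k.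
    - by rewrite /th0 sub_opp_mul; exact: scale1.
    - by rewrite subrr normr0 ltW.
    - rewrite sub_opp_mul /c (_ : v k = z k - b k); last by rewrite /z; ring.
      by rewrite mulNr -mulrA sub_opp_mul; exact: scale.
  have z0 k : 0 <= z k.
    have [rz _] := rP k; have := vr k; rewrite ler_norml /z => /andP[? ?].
    by lra.
  have z1 : \sum_k z k = 1.
    by rewrite big_split /= v0 addr0; case: zb_simplex.
  have gz := g_contraction z0 z1.
  have zv : \sum_k `|z k - b k| = \sum_k `|v k|.
    by apply: eq_bigr => k _; rewrite /z addrC addKr.
  rewrite zv in gz.
  apply: le_trans (_ : \sum_k (`|g z k - g b k| +
     `|g z k - g b k - dsoftmax th0 (fun j => c j * v j) k|) <= _).
    apply: ler_sum => k _; set D := dsoftmax _ _ _.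
    rewrite -[X in `|X| <= _](subKr (g z k - g b k) D).
    exact: ler_normB.
  by rewrite big_split /=; lra.
exists r => // e x y er xr yr xy0.
pose v k := x k - y k.
(* The vector [v] may have entries of size [2 * r]; the tangent bound is applied to its half and
   rescaled by linearity. *)
have vr k : `|2^-1 * v k| <= r.
  rewrite normrM gtr0_norm// (_ : v k = (x k - b k) - (y k - b k)); last by rewrite /v; ring.
  have := ler_normB (x k - b k) (y k - b k); have := xr k; have := yr k; lra.
have v0 : \sum_k 2^-1 * v k = 0 by rewrite -mulr_sumr xy0 mulr0.
have T := tangent _ vr v0.
have {}T : \sum_k `|dsoftmax th0 (fun j => c j * v j) k| <=
    (1 - 3 * delta / 4) * \sum_k `|v k|.
  have E1 : \sum_k `|dsoftmax th0 (fun j => c j * (2^-1 * v j)) k| =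
      2^-1 * \sum_k `|dsoftmax th0 (fun j => c j * v j) k|.
    rewrite mulr_sumr; apply: eq_bigr => k _.
    rewrite (_ : (fun j => _) = (fun j => 2^-1 * (c j * v j))).
      by rewrite dsoftmax_scale normrM ger0_norm.
    by apply/funext => j; ring.
  have E2 : \sum_k `|2^-1 * v k| = 2^-1 * \sum_k `|v k|.
    by rewrite mulr_sumr; apply: eq_bigr => k _; rewrite normrM ger0_norm.
  by rewrite E1 E2 in T; lra.
have S : \sum_k `|p e x k - p e y k - dsoftmax th0 (fun j => c j * v j) k| <=
    delta / 4 * \sum_k `|v k|.
  apply: strict => k; have [_ hr] := rP k;
    have [H1 _ H2 _] := hr e (x k) (y k) er (xr k) (yr k);
    have [H3 _ _ _] := hr e (y k) (y k) er (yr k) (yr k).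
  - by rewrite /th0 sub_opp_mul; exact: scale1.
  - by rewrite /th0 sub_opp_mul; exact: scale1.
  - by rewrite sub_opp_mul /c mulNr -mulrA sub_opp_mul; exact: scale.
apply: le_trans (_ : \sum_k (`|dsoftmax th0 (fun j => c j * v j) k| +
   `|p e x k - p e y k - dsoftmax th0 (fun j => c j * v j) k|) <= _).
  apply: ler_sum => k _; set D := dsoftmax _ _ _.
  rewrite -[X in `|X| <= _](subrK D) addrC; exact: ler_normD.
by rewrite big_split /= -/(v _); lra.
Qed.

(* When [x] is far from [zb], the distance of [x] to [zb] absorbs the [O(e)]
   error made when [p e] is replaced with [g]. *)
Lemma update_contraction :
  exists2 r, 0 < r & forall e (x y u w : 'I_q -> R), 0 < e -> 2 * e <= r ->
    (forall k, 0 <= x k) -> (forall k, x k + e <= 1) ->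
    (forall k, 0 <= y k) -> (forall k, y k + e <= 1) ->
    (forall k, `|x k - u k| <= e) -> (forall k, `|y k - w k| <= e) ->
    (forall k, 0 <= u k) -> \sum_k u k = 1 ->
    \sum_k `|w k - b k| < r -> \sum_k (x k - y k) = 0 ->
    \sum_k `|p e x k - p e y k| <=
      (1 - delta / 2) * Num.max (\sum_k `|x k - y k|) (\sum_k `|u k - w k|).
Proof.
case/andP: delta01 => d0 d1; have q0 := simplex_dim_gt0.
have [r0 r00 near] := update_contraction_near.
pose r1 := Num.min r0 1; have r10 : 0 < r1 by rewrite lt_min r00 ltr01.
have r1r0 : r1 <= r0 by rewrite ge_min lexx.
have r11 : r1 <= 1 by rewrite ge_min lexx orbT.
have /choice[M MP] : forall k, exists M, 0 <= M /\ forall e x y, 0 < e -> 0 <= x ->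
    x + e <= 1 -> 0 <= y <= 1 ->
    `|diff_quot (h k) e x - h1 k y| <= M * (`|x - y| + e).
  move=> k; have [M M0 HM] := diff_quot_uniform (dh k) (dh1 k) (@ch2 k).
  by exists M.
pose A := beta * \sum_k M k.
have A0 : 0 <= A by rewrite mulr_ge0 ?(ltW beta0)// sumr_ge0// => k _; exact: (MP k).1.
have MA k e x y : 0 < e -> 0 <= x -> x + e <= 1 -> 0 <= y <= 1 ->
    `|- (beta * diff_quot (h k) e x) - - (beta * h1 k y)| <= A * (`|x - y| + e).
  move=> e0 x0 xe y01; rewrite sub_opp_mul normrN normrM (gtr0_norm beta0) -mulrA.
  rewrite ler_pM2l//; apply: (le_trans ((MP k).2 _ _ _ e0 x0 xe y01)).
  apply: ler_wpM2r; first by rewrite addr_ge0// ltW.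
  by rewrite (bigD1 k) //= lerDl sumr_ge0// => j _; exact: (MP j).1.
(* When [x] is far, the margin [delta / 2] on a distance of at least [r1 / 2] gains [kap]. It pays
   for two softmax errors of [8 * (A * r)] each and for the distance [r] from [w] to [zb]. *)
pose kap := delta / 4 * r1; pose D := 1 + 16 * A; have D0 : 0 < D by rewrite /D; lra.
pose r := kap / D.
have kap0 : 0 < kap by rewrite mulr_gt0// divr_gt0.
have rp : 0 < r by rewrite divr_gt0.
have rD : r + 16 * (A * r) = kap.
  by rewrite (_ : _ + _ = r * D); [rewrite divfK// gt_eqF|rewrite /D; ring].
have Ar : 0 <= A * r by rewrite mulr_ge0// ltW.
have kapr : kap <= r1 / 4.
  have : delta * r1 <= 1 * r1 by apply: ler_wpM2r; exact: ltW.
  by rewrite /kap; lra.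
(* In the application [e] is 1/n, [x] and [y] are magnetizations with one site left out, and [u] and
   [w] are the full ones. *)
exists r => // e x y u w e0 er x0 x1 y0 y1 xu yw u0 u1 wr xy0.
have d2 : 0 <= 1 - delta / 2 by lra.
have wk k : `|w k - b k| <= r.
  by apply: le_trans (ltW wr); rewrite (bigD1 k) //= lerDl sumr_ge0.
have yk k : `|y k - b k| <= r + e.
  rewrite (_ : y k - b k = (w k - b k) + (y k - w k)); last by ring.
  by apply: (le_trans (ler_normD _ _)); apply: lerD.
(* The near case contracts the distance of [x] and [y], the far case that of [u] and [w]; hence the
   maximum in the conclusion. *)
have [/forallP xnear|/forallPn[k0]] := boolP [forall k, `|x k - b k| <= r0].
  apply: (@le_trans _ _ ((1 - delta / 2) * \sum_k `|x k - y k|)).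
    apply: near => // [|k]; first by rewrite e0 /=; lra.
    by apply: (le_trans (yk k)); lra.
  by rewrite ler_wpM2l// le_max lexx.
rewrite -ltNge => xfar.
have ufar : r1 / 2 <= \sum_k `|u k - b k|.
  apply: (@le_trans _ _ `|u k0 - b k0|); last by rewrite (bigD1 k0) //= lerDl sumr_ge0.
  have := ler_normD (x k0 - u k0) (u k0 - b k0); rewrite subrKA.
  by have := xu k0; lra.
have b01 k : 0 <= b k <= 1 by rewrite (ltW (zb_gt0 k)) simplex_le1.
have u01 k : 0 <= u k <= 1.
  by rewrite u0 -u1 (bigD1 k) //= lerDl sumr_ge0.
have Are : A * (2 * e) <= A * r by rewrite ler_wpM2l.
have e1 : \sum_k `|p e x k - g u k| <= 4 * (2 * (A * r)).
  apply: softmax_lipschitz => //; first lra.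
  move=> k; apply: (le_trans (MA k _ _ _ e0 (x0 k) (x1 k) (u01 k))).
  have : A * (`|x k - u k| + e) <= A * (2 * e) by apply: ler_wpM2l => //; have := xu k; lra.
  by lra.
have e2 : \sum_k `|p e y k - g b k| <= 4 * (2 * (A * r)).
  apply: softmax_lipschitz => //; first lra.
  move=> k; apply: (le_trans (MA k _ _ _ e0 (y0 k) (y1 k) (b01 k))).
  have : A * (`|y k - b k| + e) <= A * (2 * r) by apply: ler_wpM2l => //; have := yk k; lra.
  by lra.
have e3 := g_contraction u0 u1.
have e4 : \sum_k `|u k - b k| <= \sum_k `|u k - w k| + \sum_k `|w k - b k|.
  by rewrite -big_split /=; apply: ler_sum => k _; rewrite ler_distD.
apply: (@le_trans _ _ ((1 - delta / 2) * \sum_k `|u k - w k|)); last first.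
  by rewrite ler_wpM2l// le_max lexx orbT.
apply: le_trans (_ : \sum_k (`|p e x k - g u k| + `|g u k - g b k| + `|p e y k - g b k|) <= _).
  apply: ler_sum => k _.
  rewrite (_ : p e x k - p e y k =
    (p e x k - g u k) + (g u k - g b k) - (p e y k - g b k)); last by ring.
  by apply: (le_trans (ler_normB _ _)); rewrite lerD2r; exact: ler_normD.
rewrite !big_split /=.
have h3 : (1 - delta / 2) * (\sum_k `|u k - b k| - r) <= (1 - delta / 2) * \sum_k `|u k - w k|.
  by apply: ler_wpM2l => //; lra.
have h4 : delta / 2 * (r1 / 2) <= delta / 2 * \sum_k `|u k - b k|.
  by apply: ler_wpM2l => //; lra.
have h5 : (1 - delta / 2) * r <= r by rewrite ler_piMl ?(ltW rp)//; lra.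
by rewrite /kap in rD; lra.
Qed.

End Contraction.

(** * Free energy *)

Section FreeEnergy.
Context (R : realType).

(** As [ln] vanishes on nonpositive numbers, the function is 0 there, and only the limit at 0 from
    the right needs an estimate. *)
Lemma continuous_mul_ln : continuous (fun x : R => x * ln x).
Proof.
move=> x; have [x0|x0|->] := ltgtP x 0; last 1 first.
- apply/cvgrPdist_le => e e0.
  pose d := Num.min 1 ((e / 2) ^+ 2).
  have d0 : 0 < d by rewrite lt_min ltr01 exprn_gt0// divr_gt0.
  have nd : \forall y \near (0 : R), `|y| < d by exact: nbhs0_lt.
  near=> y.
  have yd : `|y| < d by near: y; exact: nd.
  rewrite mul0r sub0r normrN.
  have [y0|y0] := leP y 0; first by rewrite ln0// mulr0 normr0 ltW.
  move: yd; rewrite gtr0_norm// lt_min => /andP[y1 ye].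
  (* With [s] the square root of [y], the bound [- ln s <= s^-1] makes the absolute value of
     [y * ln y] at most [2 * s]. *)
  set s := Num.sqrt y; have s0 : 0 < s by rewrite sqrtr_gt0.
  have ys : y = s * s by rewrite -expr2 sqr_sqrtr// ltW.
  have se : s < e / 2.
    by rewrite -(ltr_pXn2r (n := 2)) ?nnegrE ?(ltW s0) ?divr_ge0 ?(ltW e0)// expr2 -ys.
  have s1 : s <= 1 by rewrite -[leRHS]sqrtr1 ler_sqrt// ltW.
  have lnV_s : - ln s <= s^-1.
    by rewrite -lnV ?posrE// ltW// ln_sublinear// invr_gt0.
  have ln_s : ln s <= 0 by rewrite ln_le0.
  rewrite ys lnM ?posrE// normrM ger0_norm ?mulr_ge0 ?(ltW s0)// ler0_norm; last by lra.
  have : s * s * (- ln s) <= s * s * s^-1 by rewrite ler_wpM2l// mulr_ge0 ?ltW.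
  rewrite mulfK ?gt_eqF//; lra.
- rewrite /continuous_at [in X in _ --> X]ln0 ?(ltW x0)// mulr0; apply: cvg_near_cst.
  have xlt : \forall y \near x, y < 0 by exact: lt_nbhsl.
  near=> y; rewrite ln0 ?mulr0//; apply/ltW.
  by near: y; exact: xlt.
- by apply: cvgM; [exact: cvg_id|exact: continuous_ln].
Unshelve. all: by end_near. Qed.

Context (q : nat).
Implicit Types (H : 'rV[R]_q -> R) (beta : R).

Lemma relative_entropy_uniform (nu : 'rV[R]_q) :
  relative_entropy nu (uniform_spin R q) = \sum_k nu 0 k * ln (nu 0 k * q%:R).
Proof. by apply: eq_bigr => k _; rewrite mxE invrK. Qed.

Lemma continuous_sum (T : topologicalType) (F : 'I_q -> T -> R) :
  (forall k, continuous (F k)) -> continuous (fun x => \sum_k F k x).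
Proof.
by move=> cF; apply: (continuous_big (@add_continuous R^o)) => k _; exact: cF.
Qed.

Lemma continuous_free_energy H beta : continuous H -> continuous (free_energy H beta).
Proof.
move=> cH.
have cbH : continuous (fun nu => beta * H nu).
  by move=> z; exact: (cvgM (cvg_cst beta) (cH z)).
suff cR : continuous (fun nu => relative_entropy nu (uniform_spin R q)).
  by move=> z; exact: cvgD (cR z) (cbH z).
apply: (@continuous_sum _ (fun k (nu : 'rV[R]_q) => nu 0 k * ln (nu 0 k / uniform_spin R q 0 k))).
move=> k z.
have q0 : q%:R != 0 :> R by rewrite pnatr_eq0 -lt0n (leq_ltn_trans _ (ltn_ord k)).
have -> : (fun nu : 'rV[R]_q => nu 0 k * ln (nu 0 k / uniform_spin R q 0 k)) =
    (fun x : R => q%:R^-1 * (x * ln x)) \o (fun nu : 'rV[R]_q => nu 0 k * q%:R).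
  by apply/funext => nu /=; rewrite mxE invrK mulrA [q%:R^-1 * _]mulrC mulfK.
apply: continuous_comp; first exact: (cvgM (@coord_continuous _ _ _ _ _ z) (cvg_cst _)).
exact: (cvgM (cvg_cst _) (@continuous_mul_ln _)).
Qed.

Lemma kl_term_le (s x : R) : 0 < s -> 0 <= x -> x * ln (s / x) <= s - x.
Proof.
move=> s0; rewrite le0r => /orP[/eqP->|x0]; first by rewrite mul0r subr0 ltW.
have sx : 0 < s / x by rewrite divr_gt0.
have := @le_ln1Dx R (s / x - 1); rewrite ltrBrDl subrr sx => /(_ isT).
rewrite addrC subrK => le; apply: (@le_trans _ _ (x * (s / x - 1))).
  by rewrite ler_wpM2l// ltW.
by rewrite mulrBr mulr1 mulrCA divff ?mulr1// gt_eqF.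
Qed.

(** Gibbs' inequality: the sum is minus the relative entropy of [x] with respect to [S]. *)
Lemma sum_kl_le (S x : 'I_q -> R) : (forall k, 0 < S k) -> (forall k, 0 <= x k) ->
  \sum_k S k = 1 -> \sum_k x k = 1 -> \sum_k x k * ln (S k / x k) <= 0.
Proof.
move=> S0 x0 S1 x1; rewrite [leRHS](_ : 0 = \sum_k (S k - x k)); last by rewrite sumrB S1 x1 subrr.
by apply: ler_sum => k _; exact: kl_term_le.
Qed.

Lemma simplex_far_compact (zb : 'rV[R]_q) (r : R) :
  compact ([set z | simplex z /\ r <= norm1 (z - zb)]).
Proof.
have c01 : compact [set v : 'rV[R]_q | forall i, v ord0 i \in `[(0 : R), 1]].
  apply: (@rV_compact _  _ (fun=> `[(0 : R), 1]%classic)).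
  by move=> _; apply: segment_compact.
apply: (subclosed_compact _ c01); last first.
  move=> z [sz _] i; rewrite /= in_itv /= simplex_le1// andbT; exact: sz.1.
have -> : [set z | simplex z /\ r <= norm1 (z - zb)] =
  (\bigcap_k (fun z : 'rV[R]_q => z 0 k) @^-1` [set x | 0 <= x]) `&`
  ((fun z : 'rV[R]_q => \sum_k z 0 k) @^-1` [set x | x = 1]) `&`
  ((fun z : 'rV[R]_q => norm1 (z - zb)) @^-1` [set x | r <= x]).
  apply/seteqP; split => z /=.
    by move=> [[z0 z1] zr]; do !split => //; move=> k _; exact: z0.
  by move=> [[z0 z1] zr]; do !split => //; move=> k; exact: z0.
have ccoord k : continuous (fun z : 'rV[R]_q => z 0 k) by exact: coord_continuous.
apply: closedI; first apply: closedI.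
- apply: closed_bigI => k _; apply: preimage_closed; last exact: closed_ge.
  by move=> z _; exact: ccoord.
- apply: preimage_closed; last exact: closed_eq.
  by move=> z _; exact: (continuous_sum ccoord).
- apply: preimage_closed; last exact: closed_ge.
  move=> z _; apply: (@continuous_sum _ (fun k (z : 'rV[R]_q) => `|(z - zb) 0 k|)).
  move=> k.
  have -> : (fun z : 'rV[R]_q => `|(z - zb) 0 k|) = (fun z => `|z 0 k - zb 0 k|).
    by apply/funext => w; rewrite !mxE.
  by move=> w; exact: (cvg_norm (cvgB (ccoord k w) (cvg_cst _))).
Qed.

(** The free energy attains its minimum on the compact set of far points; were it no larger than at
    [zb], there would be a second macrostate. *)
Lemma free_energy_gap H beta zb (r : R) : continuous H -> 0 < r ->
  equilibrium_macrostates H beta = [set zb] ->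
  exists2 c, 0 < c & forall z, simplex z -> r <= norm1 (z - zb) ->
    free_energy H beta zb + c <= free_energy H beta z.
Proof.
move=> cH r0 eqm.
have [_ zb_min] : equilibrium_macrostates H beta zb by rewrite eqm.
set K := [set z | simplex z /\ r <= norm1 (z - zb)].
have [K0|/set0P Kn0] := eqVneq K set0.
  exists 1 => // z sz zr; have : K z by []. by rewrite K0.
have [c] := EVT_min_rV Kn0 (@simplex_far_compact zb r)
  (continuous_subspaceT (continuous_free_energy (beta := beta) cH)).
rewrite inE => -[sc cr] cmin.
exists (free_energy H beta c - free_energy H beta zb).
  rewrite subr_gt0 ltNge; apply/negP => czb.
  have : equilibrium_macrostates H beta c.
    by split => // mu smu; apply: le_trans czb _; exact: zb_min.
  rewrite eqm /= => ce; move: cr; rewrite ce subrr /norm1 big1 ?leNgt ?r0//.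
  by move=> k _; rewrite mxE normr0.
by move=> z sz zr; rewrite addrC subrK; apply: cmin; rewrite inE.
Qed.

End FreeEnergy.

(** * Concentration of the Gibbs measure *)

Section LargeDeviations.
Context (R : realType) (q : nat).
Variables (H : 'rV[R]_q -> R) (h1 : 'I_q -> R -> R) (beta : R) (zb : 'rV[R]_q).
Hypotheses (beta0 : 0 < beta)
  (tangent : forall x y, H y <= H x + \sum_k h1 k (x 0 k) * (y 0 k - x 0 k))
  (zb_macro : equilibrium_macrostates H beta zb).

(** Minus [beta] times the slope of the tangent to [H] at [zb]; with [h1] the derivative,
    [softmax cc] is g at [zb]. *)
Let cc k := - (beta * h1 k (zb 0 k)).
Let W := \sum_k expR (cc k).
Local Notation S := (softmax cc).
Local Notation F := (free_energy H beta).

Let zb_simplex : simplex zb. Proof. by case: zb_macro. Qed.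

Let q_gt0 : (0 < q)%N. Proof. exact: simplex_dim_gt0 zb_simplex. Qed.

Let qR_gt0 : 0 < q%:R :> R. Proof. by rewrite ltr0n. Qed.

Let W_gt0 : 0 < W. Proof. exact: (sum_expR_gt0 cc (Ordinal q_gt0)). Qed.

Lemma ln_softmax k : ln (S k) = cc k - ln W.
Proof. by rewrite ln_div ?expRK// posrE ?expR_gt0. Qed.

Lemma energy_tangent x : beta * H x <= beta * H zb - \sum_k cc k * (x 0 k - zb 0 k).
Proof.
have := tangent zb x; rewrite -(ler_pM2l beta0) mulrDr mulr_sumr => le.
apply: (le_trans le); rewrite lerD2l -sumrN; apply: ler_sum => k _.
by rewrite /cc; lra.
Qed.

Lemma kl_term_split (nu : 'rV[R]_q) k : 0 <= nu 0 k ->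
  nu 0 k * ln (S k / nu 0 k) =
  nu 0 k * cc k + nu 0 k * (ln q%:R - ln W) - nu 0 k * ln (nu 0 k * q%:R).
Proof.
rewrite le0r => /orP[/eqP->|nu0]; first by rewrite !mul0r; ring.
rewrite ln_div ?posrE ?softmax_gt0// ln_softmax lnM ?posrE//; ring.
Qed.

(** [S] is the uniform law tilted by [expR (cc k)], so the relative entropies with respect to the
    two laws differ by an affine function of [nu]. *)
Lemma sum_kl_split (nu : 'rV[R]_q) : simplex nu ->
  \sum_k nu 0 k * ln (S k / nu 0 k) =
  \sum_k nu 0 k * cc k + (ln q%:R - ln W) - relative_entropy nu (uniform_spin R q).
Proof.
move=> [nu0 nu1]; rewrite (eq_bigr _ (fun k _ => kl_term_split (nu0 k))).
by rewrite sumrB big_split /= -mulr_suml nu1 mul1r relative_entropy_uniform.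
Qed.

Let Srow : 'rV[R]_q := \row_k S k.

Let Srow_simplex : simplex Srow.
Proof.
split=> [k|]; first by rewrite mxE softmax_ge0.
under eq_bigr do rewrite mxE; exact: sum_softmax.
Qed.

(* By concavity, [zb] minimizes the free energy linearized at [zb], whose
   minimizer is [S]. *)
Lemma macrostate_kl_ge0 : 0 <= \sum_k zb 0 k * ln (S k / zb 0 k).
Proof.
have := zb_macro.2 Srow Srow_simplex; rewrite /free_energy.
have := energy_tangent Srow; have := sum_kl_split Srow_simplex.
rewrite big1 => [|k _]; last first.
  by rewrite mxE divff ?ln1 ?mulr0// gt_eqF// softmax_gt0.
rewrite sum_kl_split//.
have -> : \sum_k cc k * (Srow 0 k - zb 0 k) =
  \sum_k Srow 0 k * cc k - \sum_k zb 0 k * cc k.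
  by rewrite -sumrB; apply: eq_bigr => k _; ring.
lra.
Qed.

(** If the k-th coordinate vanished, the remaining terms of the sum in [macrostate_kl_ge0] would add
    up to at most [- S k], a negative number. *)
Lemma macrostate_gt0 k : 0 < zb 0 k.
Proof.
case: zb_simplex => z0 z1; rewrite lt_def z0 andbT; apply/eqP => zk.
have := macrostate_kl_ge0; rewrite (bigD1 k) //= zk mul0r add0r leNgt => /negP; apply.
apply: le_lt_trans (_ : \sum_(j | j != k) (S j - zb 0 j) < 0).
  by apply: ler_sum => j _; apply: kl_term_le; rewrite ?softmax_gt0.
have S1 := sum_softmax cc q_gt0.
rewrite (bigD1 k) //= in S1; rewrite (bigD1 k) //= zk add0r in z1.
by rewrite sumrB z1 subr_lt0 -[ltRHS]S1 ltrDr softmax_gt0.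
Qed.

(** * Partition function and counting of magnetizations *)

Lemma sum_spins (n : nat) (s : config q n) (f : 'I_q -> R) : (0 < n)%N ->
  \sum_(i < n) f (s i) = n%:R * \sum_k magnetization R s 0 k * f k.
Proof.
move=> n0; rewrite mulr_sumr.
under [RHS]eq_bigr => k _ do
  rewrite magnetizationE mulrA mulrCA divff ?mulr1 ?pnatr_eq0 -?lt0n// mulr_suml.
rewrite exchange_big /=; apply: eq_bigr => i _.
rewrite (bigD1 (s i)) //= eqxx mul1r big1 ?addr0// => k.
by rewrite eq_sym => /negPf ->; rewrite mul0r.
Qed.

Lemma sum_prod_config (n : nat) (f : 'I_q -> R) :
  \sum_(s : config q n) \prod_(i < n) f (s i) = (\sum_k f k) ^+ n.
Proof.
rewrite -(bigA_distr_bigA (fun (i : 'I_n) (k : 'I_q) => f k)) /=.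
by rewrite prodr_const card_ord.
Qed.

(** Bounding [H] above by its tangent at [zb] makes the weights factor over the sites, so the sum is
    an n-th power. Gibbs' inequality between [zb] and [S] compares its base with the free energy. *)
Lemma partition_function_ge (n : nat) : (0 < n)%N ->
  expR (- (n%:R * F zb)) <= \sum_(s : config q n) boltzmann H beta s * prior R s.
Proof.
move=> n0; pose a := - (beta * H zb) - \sum_k zb 0 k * cc k.
have low (s : config q n) : expR (n%:R * a) * \prod_(i < n) expR (cc (s i)) <= boltzmann H beta s.
  rewrite -expR_sum -expRD ler_expR sum_spins// -mulrDr.
  have -> : beta * n%:R * H (magnetization R s) = n%:R * (beta * H (magnetization R s)) by ring.
  rewrite -mulrN ler_wpM2l//.
  have := energy_tangent (magnetization R s).
  have -> : \sum_k cc k * (magnetization R s 0 k - zb 0 k) =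
    \sum_k magnetization R s 0 k * cc k - \sum_k zb 0 k * cc k.
    by rewrite -sumrB; apply: eq_bigr => k _; ring.
  by rewrite /a; lra.
apply: le_trans (_ : \sum_(s : config q n)
   (expR (n%:R * a) * \prod_(i < n) expR (cc (s i))) * q%:R^-1 ^+ n <= _); last first.
  apply: ler_sum => s _; rewrite prior_const; apply: ler_wpM2r; last exact: low.
  by rewrite exprn_ge0// invr_ge0.
rewrite -mulr_suml -mulr_sumr (sum_prod_config n (fun k => expR (cc k))) -/W.
have -> : W ^+ n = expR (n%:R * ln W) by rewrite expRM_natl lnK// posrE.
have -> : q%:R^-1 ^+ n = expR (n%:R * (- ln q%:R)) :> R.
  by rewrite expRM_natl expRN lnK// posrE.
rewrite -!expRD ler_expR -!mulrDr -mulrN ler_wpM2l//.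
have := sum_kl_le (fun k => softmax_gt0 cc k) zb_simplex.1 (sum_softmax cc q_gt0) zb_simplex.2.
rewrite sum_kl_split// /free_energy /a; lra.
Qed.

Lemma gibbs_le (n : nat) (s : config q n) : (0 < n)%N ->
  gibbs H beta s <= (\prod_(i < n) magnetization R s 0 (s i)) *
    expR (- (n%:R * (F (magnetization R s) - F zb))).
Proof.
move=> n0; set L := magnetization R s.
have L0 i : 0 < L 0 (s i).
  rewrite /L magnetizationE divr_gt0 ?ltr0n// (bigD1 i) //= eqxx.
  by rewrite ltr_wpDr// sumr_ge0.
have Z0 := lt_le_trans (expR_gt0 _) (partition_function_ge n0).
rewrite /gibbs ler_pdivrMr//.
(* [n] times the entropy is the sum over sites of [ln (q * L_(s i))]; every spin that occurs has
   positive frequency, so the logarithms invert. *)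
have -> : \prod_(i < n) L 0 (s i) =
    expR (n%:R * (relative_entropy L (uniform_spin R q))) * prior R s.
  have -> : prior R s = \prod_(i < n) expR (- ln q%:R).
    by apply: eq_bigr => i _; rewrite mxE expRN lnK// posrE.
  rewrite relative_entropy_uniform -(sum_spins s (fun k => ln (L 0 k * q%:R)))//.
  rewrite expR_sum -big_split /=; apply: eq_bigr => i _.
  by rewrite lnM ?posrE// -expRD addrK lnK// posrE.
set Z := \sum_w _; set E1 := expR _; set E2 := expR _.
rewrite (_ : E1 * prior R s * E2 * Z = E1 * E2 * Z * prior R s); last by ring.
rewrite /E1 /E2 -expRD /boltzmann -/L; apply: ler_wpM2r.
  by rewrite prior_const exprn_ge0// invr_ge0.
apply: le_trans (_ : expR (n%:R * relative_entropy L (uniform_spin R q) +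
  - (n%:R * (F L - F zb))) * expR (- (n%:R * F zb)) <= _).
  by rewrite -expRD ler_expR /free_energy; lra.
by rewrite ler_wpM2l ?expR_ge0 ?partition_function_ge.
Qed.

(** Configurations with the same spin counts share one law [L], and the sum over them is a
    probability under the product of [L], at most 1. There are at most [n.+1 ^ q] count vectors. *)
Lemma sum_prod_magnetization_le (n : nat) : (0 < n)%N ->
  \sum_(s : config q n) \prod_(i < n) magnetization R s 0 (s i) <= (n.+1 ^ q)%:R.
Proof.
move=> n0.
pose cnt (s : config q n) : {ffun 'I_q -> 'I_n.+1} := [ffun k => inord #|[pred i | s i == k]|].
have magE s s0 : cnt s = cnt s0 -> magnetization R s = magnetization R s0.
  move=> /ffunP E; apply/rowP => k; rewrite !mxE.
  have := E k; rewrite !ffunE => /(congr1 val) /=; rewrite !inordK => [->//||];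
    by rewrite ltnS -[X in (_ <= X)%N](card_ord n) max_card.
rewrite (partition_big cnt predT) //=.
apply: le_trans (_ : \sum_(c : {ffun 'I_q -> 'I_n.+1}) 1 <= _); last first.
  by rewrite sumr_const card_ffun !card_ord.
apply: ler_sum => c _.
have [[s0 /eqP s0c]|none] := pselect (exists s, cnt s == c); last first.
  by rewrite big_pred0// => s; apply/negP => sc; apply: none; exists s.
rewrite [leRHS](_ : 1 = \sum_(s : config q n) \prod_(i < n) magnetization R s0 0 (s i)); last first.
  by rewrite sum_prod_config sum_magnetization// expr1n.
have m0 k : 0 <= magnetization R s0 0 k := (simplex_magnetization R s0 n0).1 k.
rewrite [leRHS](bigID (fun s => cnt s == c)) /= -[leLHS]addr0; apply: lerD.
  by apply: ler_sum => s /eqP sc; rewrite (magE s s0) ?s0c.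
by apply: sumr_ge0 => s _; apply: prodr_ge0 => i _.
Qed.

Lemma gibbs_far_le (n : nat) (r c : R) : (0 < n)%N ->
  (forall z, simplex z -> r <= norm1 (z - zb) -> F zb + c <= F z) ->
  \sum_(s : config q n | r <= norm1 (magnetization R s - zb)) gibbs H beta s
    <= (n.+1 ^ q)%:R * expR (- (n%:R * c)).
Proof.
move=> n0 gap; apply: le_trans (_ : \sum_(s : config q n)
  (\prod_(i < n) magnetization R s 0 (s i)) * expR (- (n%:R * c)) <= _); last first.
  by rewrite -mulr_suml ler_wpM2r ?expR_ge0// sum_prod_magnetization_le.
have P0 (s : config q n) : 0 <= \prod_(i < n) magnetization R s 0 (s i).
  by apply: prodr_ge0 => i _; exact: (simplex_magnetization R s n0).1.
rewrite [leRHS](bigID (fun s : config q n => r <= norm1 (magnetization R s - zb))) /=.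
rewrite -[leLHS]addr0; apply: lerD; last first.
  by apply: sumr_ge0 => s _; rewrite mulr_ge0 ?expR_ge0.
apply: ler_sum => s far; apply: (le_trans (gibbs_le s n0)).
rewrite ler_wpM2l// ler_expR lerN2 ler_wpM2l//.
by have := gap _ (simplex_magnetization R s n0) far; lra.
Qed.

End LargeDeviations.

(** * Mixing time *)

Lemma expR_ge_pow (R : realType) (x : R) (m : nat) : 0 <= x -> x ^+ m.+1 / (m.+1)`!%:R <= expR x.
Proof. by move=> x0; apply: le_trans (expR_ge1Dxn m x0); rewrite lerDr. Qed.

(** The exponential dominates the term of degree [j.+1] of its series, one power more than is needed
    to cancel the polynomial. *)
Lemma poly_expR_decay (R : realType) (c : R) (j : nat) : 0 < c ->
  exists2 K, 0 <= K & forall n : nat,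
    n.+1%:R ^+ j * expR (- (n%:R * c)) <= K / n.+1%:R.
Proof.
move=> c0; pose B := (j.+1)`!%:R / c ^+ j.+1.
have B0 : 0 <= B by rewrite divr_ge0 ?exprn_ge0 ?(ltW c0).
exists (expR c * B); first by rewrite mulr_ge0 ?expR_ge0.
move=> n; have N0 : 0 < n.+1%:R :> R by rewrite ltr0n.
have nc0 : 0 < n.+1%:R * c by rewrite mulr_gt0.
have -> : expR (- (n%:R * c)) = expR c * expR (- (n.+1%:R * c)).
  by rewrite -expRD -natr1; congr expR; ring.
have le : expR (- (n.+1%:R * c)) <= B / n.+1%:R ^+ j.+1.
  rewrite expRN -[leRHS]invrK lef_pV2 ?posrE ?expR_gt0//; last first.
    by rewrite invr_gt0 !mulr_gt0 ?invr_gt0 ?exprn_gt0 ?ltr0n ?fact_gt0.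
  apply: le_trans (expR_ge_pow j (ltW nc0)).
  rewrite le_eqVlt; apply/orP; left; apply/eqP; rewrite /B exprMn; field.
  by rewrite !gt_eqF ?exprn_gt0 ?ltr0n ?fact_gt0.
rewrite mulrCA -mulrA ler_wpM2l ?expR_ge0//.
apply: (le_trans (ler_wpM2l _ le)); first by rewrite exprn_ge0// ltW.
rewrite le_eqVlt; apply/orP; left; apply/eqP; rewrite exprS; field.
by rewrite !gt_eqF ?exprn_gt0.
Qed.

Theorem theorem9p2 (R : realType) (q : nat) (H : 'rV[R]_q -> R)
    (beta : R) (zb : 'rV[R]_q)
    (H_concave : concave H) (H_C3 : class_C 3 H) (H_sep : separable H)
    (beta_gt0 : 0 < beta)
    (zb_unique : equilibrium_macrostates H beta = [set zb])
    (H_RS : riemann_sum_condition H beta zb)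
    (H_LC : local_contraction H beta zb)
    (eps : R) (eps_gt0 : 0 < eps) (eps_lt1 : eps < 1) :
  exists C : R, \forall n \near \oo,
    (t_mix H beta n eps <= (C * (n%:R * ln n%:R))%:E)%E.
Proof.
have [delta [U _]] := H_RS; have delta01 := U.1; have /andP[d0 d1] := delta01.
have zb_macro : equilibrium_macrostates H beta zb by rewrite zb_unique.
have zb_simplex := zb_macro.1; have q_gt0 := simplex_dim_gt0 zb_simplex.
have [h [h1 [h2 [hE dh dh1 ch2 pE]]]] := separable_C2 H_C3 H_sep.
have ch1 k : continuous (h1 k).
  by move=> x; apply/differentiable_continuous/derivable1_diffP; case: (dh1 k x).
have tangent := separable_concave_tangent H_concave hE dh ch1.
have zb_gt0 := macrostate_gt0 beta_gt0 tangent zb_macro.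
have gE := g_coord_softmax beta pE.
have g_contraction (z : 'I_q -> R) : (forall k, 0 <= z k) -> \sum_k z k = 1 ->
    \sum_k `|softmax (fun l => - (beta * h1 l (z l))) k -
             softmax (fun l => - (beta * h1 l (zb 0 l))) k|
      <= (1 - delta) * \sum_k `|z k - zb 0 k|.
  move=> z0 z1; have sz : simplex (\row_k z k).
    by split=> [k|]; [rewrite mxE|under eq_bigr do rewrite mxE].
  have := uniform_condition_g_dist U sz.
  rewrite /norm1; under eq_bigr do rewrite !gE.
  under [X in _ <= _ * X -> _]eq_bigr do rewrite !mxE.
  by under [fun l => - (beta * h1 l ((\row_k z k) 0 l))]funext do rewrite mxE.
have [r r_gt0 contr] := update_contraction beta_gt0 delta01 dh dh1 ch2 zb_simplex zb_gt0
  g_contraction.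
have [c c_gt0 gap] := free_energy_gap H_C3.1 r_gt0 zb_unique.
pose a := delta / 2; have a01 : 0 <= a <= 1 by apply/andP; rewrite /a; split; lra.
have a_gt0 : 0 < a by rewrite divr_gt0.
have mix n m : (0 < n)%N -> 2 * n%:R^-1 <= r ->
    mixing_distance H beta n m <= (1 - a / n%:R) ^+ m * n%:R +
      m%:R * ((n.+1 ^ q)%:R * expR (- (n%:R * c))).
  move=> n0 nr; have ni0 : 0 < n%:R^-1 :> R by rewrite invr_gt0 ltr0n.
  apply: le_trans (mixing_distance_le
    (bad := fun s : config q n => r <= norm1 (magnetization R s - zb)) m q_gt0 n0 a01 _) _.
    move=> s t i; rewrite -ltNge => near_zb.
    under eq_bigr do rewrite !(update_prob_softmax beta n0 hE).
    rewrite ler_pdivrMl//.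
    apply: le_trans (contr n%:R^-1 (off_magnetization R s i) (off_magnetization R t i)
      (fun k => magnetization R s 0 k) (fun k => magnetization R t 0 k)
      ni0 nr _ _ _ _ _ _ _ _ _ _) _.
    + exact: off_ge0.
    + by move=> k; exact: off_le.
    + exact: off_ge0.
    + by move=> k; exact: off_le.
    + exact: off_magnetization_dist.
    + exact: off_magnetization_dist.
    + exact: (simplex_magnetization R s n0).1.
    + exact: sum_magnetization.
    + by apply: le_lt_trans near_zb; rewrite /norm1; apply: ler_sum => k _; rewrite !mxE.
    + exact: sum_off_sub.
    (* Magnetizations differ by at most twice the Hamming distance over [n]; this 2 offsets the half
       in the total variation distance. *)
    rewrite mulrCA; apply: ler_wpM2l; first by case/andP: a01; rewrite /a; lra.
    by rewrite ge_max off_dist magnetization_dist.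
  by rewrite lerD2l ler_wpM2l// (gibbs_far_le beta_gt0 tangent zb_macro).
(* [n.+1 ^ q] counts the magnetizations, and two more powers bound the number [m] of steps. *)
have [K K0 decay] := poly_expR_decay (q.+2) c_gt0.
(* The summand 1 absorbs the rounding of the number of steps, since [n * ln n] is at least 1. *)
pose A := 2 / a + 1; have A0 : 0 < A by rewrite addr_gt0// divr_gt0.
exists A; near=> n.
have n_e : expR 1 <= n%:R :> R by near: n; exact: nbhs_infty_ger.
have n_r : 2 / r <= n%:R :> R by near: n; exact: nbhs_infty_ger.
have n_eps : (1 + A * K) / eps <= n%:R :> R by near: n; exact: nbhs_infty_ger.
have n_gt0 : 0 < n%:R :> R by apply: lt_le_trans n_e; exact: expR_gt0.
have n0 : (0 < n)%N by rewrite -(ltr0n R).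
have n1 : 1 <= n%:R :> R by rewrite ler1n.
have ln1 : 1 <= ln n%:R :> R by rewrite -ler_expR lnK// posrE.
have lnn : ln n%:R <= n%:R :> R by apply/ltW/ln_sublinear.
(* After this many steps the contraction factor is at most 1/n^2; one power of [n] compensates the
   initial distance and the other makes the term vanish. *)
pose x := 2 / a * (n%:R * ln n%:R); have x0 : 0 <= x.
  by rewrite !mulr_ge0 ?invr_ge0 ?(ltW a_gt0)// (le_trans _ ln1).
have [m xm mx] : exists2 m : nat, x <= m%:R & m%:R <= x + 1.
  have /andP[tx xt] := truncn_itv x0.
  by exists (Num.trunc x).+1; [exact: ltW|rewrite -natr1 lerD2r].
have nln1 : 1 <= n%:R * ln n%:R :> R by rewrite -[leLHS]mulr1 ler_pM.
have mA : m%:R <= A * (n%:R * ln n%:R) by rewrite /A mulrDl mul1r; rewrite /x in mx; lra.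
apply: le_trans (_ : (m%:R)%:E <= _)%E; last by rewrite lee_fin.
apply: ereal_inf_lbound; exists m => //=.
have nr : 2 * n%:R^-1 <= r by rewrite ler_pdivrMr// mulrC -ler_pdivrMr.
apply: (le_trans (mix n m n0 nr)).
have part1 : (1 - a / n%:R) ^+ m * n%:R <= 1 / n%:R.
  have an : 0 <= 1 - a / n%:R.
    by rewrite subr_ge0 ler_pdivrMr// mul1r (le_trans _ n1)//; case/andP: a01.
  have e1 : 1 - a / n%:R <= expR (- (a / n%:R)) by exact: expR_ge1Dx.
  have e2 : (1 - a / n%:R) ^+ m <= expR (- (a / n%:R)) ^+ m.
    by apply: lerXn2r; rewrite ?nnegrE ?expR_ge0.
  have e3 : expR (- (a / n%:R)) ^+ m <= (n%:R ^+ 2)^-1.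
    rewrite -expRM_natl -[n%:R in leRHS]lnK ?posrE// -expRM_natl -expRN ler_expR.
    rewrite mulrN lerN2.
    have -> : 2 * ln n%:R = x * (a / n%:R) by rewrite /x; field; rewrite !gt_eqF.
    by rewrite ler_wpM2r// divr_ge0// ltW.
  apply: le_trans (ler_wpM2r (ltW n_gt0) (le_trans e2 e3)) _.
  by rewrite expr2 invfM -mulrA mulVf ?gt_eqF// mul1r mulr1.
have part2 : m%:R * ((n.+1 ^ q)%:R * expR (- (n%:R * c))) <= A * K / n%:R.
  have m2 : m%:R <= A * n.+1%:R ^+ 2.
    apply: (le_trans mA); rewrite ler_wpM2l ?(ltW A0)// expr2.
    by apply: ler_pM => //; rewrite ?(le_trans _ ln1)// ?(le_trans lnn)// ler_nat.
  apply: (@le_trans _ _ (A * (n.+1%:R ^+ q.+2 * expR (- (n%:R * c))))).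
    have -> : n.+1%:R ^+ q.+2 = n.+1%:R ^+ 2 * n.+1%:R ^+ q :> R by rewrite -exprD.
    rewrite natrX -[in leRHS]mulrA [leRHS]mulrA; apply: ler_wpM2r => //.
  rewrite -mulrA ler_wpM2l ?(ltW A0)//; apply: (le_trans (decay n)).
  by rewrite ler_wpM2l// lef_pV2 ?posrE ?ltr0n// ler_nat.
apply: le_trans (lerD part1 part2) _; rewrite -mulrDl ler_pdivrMr// [eps * _]mulrC.
by rewrite -ler_pdivrMr.
Unshelve. all: by end_near. Qed.
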